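(* Let $q\in\mathbb{C}$. There is a $\mathbb{C}$-algebra homomorphism $\Theta_q:\mathrm{QSym}\to\mathcal{P}^{(q)}$ such that for every positive integer $n$ and every subset $I\subseteq[n-1]$, $$\Theta_q\left(L^{(0)}_{n,I}\right)=L^{(q)}_{n,I}.$$ Moreover, the restriction of $\Theta_q$ to $\Lambda$ is exactly $\theta_{-q}$; that is, $\Lambda_{-q}\subseteq\mathcal{P}^{(q)}$ and the square with top map $\Theta_q:\mathrm{QSym}\to\mathcal{P}^{(q)}$, bottom map $\theta_{-q}:\Lambda\to\Lambda_{-q}$, and vertical maps the inclusions $\Lambda\hookrightarrow\mathrm{QSym}$ and $\Lambda_{-q}\hookrightarrow\mathcal{P}^{(q)}$ is commutative.
   Context: Notation. $X=\{x_1,x_2,x_3,\dots\}$ is a set of indeterminates, $\mathbb{P}=\{1,2,3,\dots\}$, $[n]=\{1,\dots,n\}$, and $\mathbb{P}^{\pm}$ is the set of all positive and negative integers, totally ordered by $-1<1<-2<2<-3<3<\cdots$; $-\mathbb{P}=\{-n: n\in\mathbb{P}\}\subseteq\mathbb{P}^\pm$. In expressions $[f(i)<0]$ below, ''$<0$'' means $f(i)\in-\mathbb{P}$; the bracket is $1$ if this holds and $0$ otherwise. $\Lambda$ is the ring of symmetric functions over $\mathbb{C}$ in $X$, and $\mathrm{QSym}\supseteq\Lambda$ is the ring of quasisymmetric functions over $\mathbb{C}$ in $X$ (bounded-degree power series in which, for all $i_1<\dots<i_p$, the coefficients of $x_1^{k_1}\cdots x_p^{k_p}$ and $x_{i_1}^{k_1}\cdots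 x_{i_p}^{k_p}$ agree). $h_n$ denotes the complete homogeneous symmetric function. The homomorphism $\theta_t$. For $t\in\mathbb{C}$ the symmetric functions $q_n(X;t)$, $n\ge0$, are defined by $\sum_{n\ge 0}q_n(X;t)u^n=\prod_i\frac{1-x_itu}{1-x_iu}$. $\Lambda_t$ is the subalgebra of $\Lambda$ generated by all $q_n(X;t)$, and $\theta_t:\Lambda\to\Lambda_t$ is the $\mathbb{C}$-algebra homomorphism with $\theta_t(h_n)=q_n(X;t)$ for all $n\ge0$. $q$-fundamental quasisymmetric functions. For a labelled poset $P=([n],<_P)$ (an arbitrary partial order on $[n]$), an enriched $P$-partition is a map $f:[n]\to\mathbb{P}^\pm$ such that: (i) if $i<_Pj$ and $i<j$, then $f(i)<f(j)$ or $f(i)=f(j)\in\mathbb{P}$; (ii) if $i<_Pj$ and $i>j$, then $f(i)<f(j)$ or $f(i)=f(j)\in-\mathbb{P}$. Let $\mathcal{L}_{\mathbb{P}^\pm}(P)$ be the set of these maps and, for $q\in\mathbb{C}$, $\Gamma^{(q)}([n],<_P)=\sum_{f\in\mathcal{L}_{\mathbb{P}^\pm}(P)}\prod_{1\le i\le n}q^{[f(i)<0]}x_{|f(i)|}\in\mathbb{C}[[X]]$ (with $0^0=1$). For a permutation $\pi=\pi_1\cdots\pi_n$ of $[n]$, let $<_\pi$ be the total order on $[n]$ with $\pi_i<_\pi\pi_j$ if and only if $i<j$, and set $L^{(q)}_\pi=\Gamma^{(q)}([n],<_\pi)\in\mathrm{QSym}$. This depends only on $n$ and the descent set $\mathrm{Des}(\pi)=\{1\le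 i\le n-1:\pi_i>\pi_{i+1}\}$; for $I\subseteq[n-1]$ one writes $L^{(q)}_{n,I}=L^{(q)}_\pi$ for any permutation $\pi$ of $[n]$ with $\mathrm{Des}(\pi)=I$ (and $L^{(q)}_{0,\emptyset}=1$). $\mathcal{P}^{(q)}$ denotes the subalgebra of $\mathrm{QSym}$ spanned by all $L^{(q)}_{n,I}$, $n\ge0$, $I\subseteq[n-1]$. *)

(* Defs.v *)
From HB Require Import structures.
From mathcomp Require Import all_boot all_order all_algebra all_fingroup.
From mathcomp Require Import finmap multiset.
From mathcomp Require Import classical_sets boolp functions cardinality fsbigop.
From mathcomp Require Import reals complex.

Set Implicit Arguments.
Unset Strict Implicit.
Unset Printing Implicit Defensive.

Import Order.TTheory GRing.Theory.

Local Open Scope classical_set_scope.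
Local Open Scope mset_scope.
Local Open Scope ring_scope.

(* A power series over K in indeterminates indexed by I is the family of its
   coefficients; the monomial \prod_i x_i^(m i) is the finite multiset m. *)
Record fps (K : Type) (I : choiceType) := Fps { coef :> {mset I} -> K }.

HB.instance Definition _ (K : Type) (I : choiceType) := [isNew for @coef K I].
HB.instance Definition _ (K : choiceType) (I : choiceType) :=
  [Choice of fps K I by <:].

Lemma fpsP (K : Type) (I : choiceType) (f g : fps K I) : f =1 g <-> f = g.
Proof.
split=> [|->//]; case: f g => [f] [g] /= fg; congr Fps; exact/funext.
Qed.

Section Divisors.
Variable I : choiceType.
Implicit Types m d e : {mset I}.

Lemma finite_mdivisors m : finite_set [set d : {mset I} | d `<=` m].
Proof.
pose h (s : {ffun finsupp m -> 'I_(size m).+1}) : {mset I} :=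
  [fsfun x : finsupp m => s x : nat].
apply: (@sub_finite_set _ _ [set h s | s in setT]); last first.
  exact: finite_image.
move=> d /= dm; exists [ffun x => inord (d (val x))] => //.
apply/fsfunP => x; rewrite fsfun_ffun.
have dx : (d x <= m x)%N by move/msubsetP: dm.
case: insubP => [u xm ux|] /=; last first.
  by rewrite mem_finsupp negbK => /eqP mx; move: dx; rewrite mx leqn0 => /eqP.
rewrite ffunE ux inordK// ltnS (leq_trans dx)//.
by rewrite -count_mem_mset count_size.
Qed.

Definition mdivisors m : {fset {mset I}} := fset_set [set d | d `<=` m].

Lemma in_mdivisors m d : (d \in mdivisors m) = (d `<=` m).
Proof.
rewrite in_fset_set; last exact: finite_mdivisors.
by apply/idP/idP; rewrite inE.
Qed.

Lemma msub_Dl d e : d `<=` d `+` e.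
Proof. by apply/msubsetP => x; rewrite msetE2 leq_addr. Qed.

Lemma msub_Dr d e : d `<=` e `+` d.
Proof. by rewrite msetDC msub_Dl. Qed.

End Divisors.

Section Ring.
Variables (K : comNzRingType) (I : choiceType).
Local Notation S := (fps K I).
Implicit Types (f g h : S) (m d e : {mset I}).

Definition fps0 : S := Fps (fun=> 0).
Definition fps1 : S := Fps (fun m => (m == mset0)%:R).
Definition fpsN f : S := Fps (fun m => - f m).
Definition fpsD f g : S := Fps (fun m => f m + g m).
Definition fpsM f g : S :=
  Fps (fun m => \sum_(p \in [set p | p.1 `+` p.2 = m]) f p.1 * g p.2).
Definition fpsZ (c : K) f : S := Fps (fun m => c * f m).

Lemma fpsME f g m (r : seq {mset I}) : uniq r -> {subset mdivisors m <= r} ->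
  fpsM f g m = \sum_(d <- r) \sum_(e <- r | d `+` e == m) f d * g e.
Proof.
move=> ur sr; rewrite /= (fsbigE [seq (d, e) | d <- r, e <- [seq e <- r | d `+` e == m]]).
- rewrite big_mkcond big_allpairs_dep/=; apply: eq_bigr => d _.
  rewrite -big_mkcond big_filter_cond; apply: eq_bigl => e.
  by rewrite andb_idr// => /eqP <-; rewrite inE.
- apply: allpairs_uniq_dep => [|d _|]; rewrite ?filter_uniq//.
  by move=> [a b] [c d] _ _ [-> ->].
- by move=> [d e] /= /allpairsPdep[x [y [_]]]; rewrite mem_filter => /andP[/eqP + _] [-> ->].
- move=> [d e] /= de /negP[]; apply/allpairsPdep; exists d, e.
  rewrite mem_filter de eqxx; split=> //; apply: sr; rewrite in_mdivisors -de.
    exact: msub_Dl.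
  exact: msub_Dr.
Qed.

Lemma fpsME0 f g m : fpsM f g m =
  \sum_(d <- mdivisors m) \sum_(e <- mdivisors m | d `+` e == m) f d * g e.
Proof. by apply: fpsME => //; apply: fset_uniq. Qed.

Lemma sub_mdivisors m d : d `<=` m -> {subset mdivisors d <= mdivisors m}.
Proof.
by move=> dm x; rewrite !in_mdivisors => xd; apply: msubset_trans dm.
Qed.

Lemma fpsDA : associative fpsD.
Proof. by move=> f g h; apply/fpsP => m /=; rewrite addrA. Qed.
Lemma fpsDC : commutative fpsD.
Proof. by move=> f g; apply/fpsP => m /=; rewrite addrC. Qed.
Lemma fps0D : left_id fps0 fpsD.
Proof. by move=> f; apply/fpsP => m /=; rewrite add0r. Qed.
Lemma fpsND : left_inverse fps0 fpsN fpsD.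
Proof. by move=> f; apply/fpsP => m /=; rewrite addNr. Qed.

HB.instance Definition _ := GRing.isZmodule.Build S fpsDA fpsDC fps0D fpsND.

Lemma fpsMC : commutative fpsM.
Proof.
move=> f g; apply/fpsP => m; rewrite !fpsME0.
under eq_bigr do rewrite big_mkcond.
rewrite exchange_big/=; apply: eq_bigr => d _; rewrite [RHS]big_mkcond/=.
by apply: eq_bigr => e _; rewrite msetDC mulrC.
Qed.

Lemma fps1M : left_id fps1 fpsM.
Proof.
move=> f; apply/fpsP => m; rewrite fpsME0.
have h0 : mset0 \in mdivisors m.
  by rewrite in_mdivisors; apply/msubsetP => x; rewrite mset0E.
rewrite (big_fsetD1 mset0)//= [X in _ + X]big1_fset ?addr0; last first.
  move=> d; rewrite !inE => /andP[/negbTE d0 _] _.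
  by rewrite big1// => e _; rewrite d0 mul0r.
have hm : m \in mdivisors m by rewrite in_mdivisors msubset_refl.
rewrite big_mkcond (big_fsetD1 m)//= [X in _ + X]big1_fset ?addr0; last first.
  by move=> e; rewrite !inE mset0D => /andP[/negbTE -> _] _.
by rewrite mset0D !eqxx mul1r.
Qed.

Lemma fpsMDl : left_distributive fpsM fpsD.
Proof.
move=> f g h; apply/fpsP => m.
transitivity (fpsM f h m + fpsM g h m); last by [].
rewrite !fpsME0 -big_split/=.
by apply: eq_bigr => d _; rewrite -big_split; apply: eq_bigr => e _; rewrite mulrDl.
Qed.

Lemma fpsMA : associative fpsM.
Proof.
pose T f g h m := \sum_(a <- mdivisors m) \sum_(b <- mdivisors m)
  \sum_(e <- mdivisors m) if a `+` b `+` e == m then f a * g b * h e else 0.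
have TE f g h m : fpsM (fpsM f g) h m = T f g h m.
  rewrite fpsME0.
  transitivity (\sum_(d <- mdivisors m) \sum_(e <- mdivisors m)
      \sum_(a <- mdivisors m) \sum_(b <- mdivisors m)
      if (a `+` b == d) && (d `+` e == m) then f a * g b * h e else 0).
    apply: eq_big_seq => d; rewrite in_mdivisors => dm.
    rewrite big_mkcond; apply: eq_bigr => e _.
    case: ifP => _; last by rewrite big1// => a _; rewrite big1// => b _; rewrite andbF.
    rewrite (fpsME _ _ (fset_uniq (mdivisors m)) (sub_mdivisors dm)) mulr_suml.
    apply: eq_bigr => a _; rewrite mulr_suml big_mkcond.
    by apply: eq_bigr => b _; rewrite andbT.
  rewrite exchange_big; under eq_bigr do rewrite exchange_big.
  rewrite exchange_big; apply: eq_bigr => a _ /=.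
  under eq_bigr do rewrite exchange_big.
  rewrite exchange_big; apply: eq_bigr => b _ /=; apply: eq_bigr => e _.
  case: ifPn => [/eqP abe|abe].
    have ab : a `+` b \in mdivisors m by rewrite in_mdivisors -abe msub_Dl.
    rewrite (big_fsetD1 _ ab)/= eqxx abe eqxx big1_fset ?addr0// => d.
    by rewrite !inE eq_sym => /andP[/negbTE ->].
  by rewrite big1// => d _; case: eqP => //= <-; rewrite (negbTE abe).
move=> f g h; rewrite fpsMC; apply/fpsP => m; rewrite !TE /T.
under eq_bigr do rewrite exchange_big.
rewrite exchange_big/=.
apply: eq_bigr => a _; apply: eq_bigr => b _; apply: eq_bigr => e _.
by rewrite msetDC msetDA [in LHS]mulrC mulrA.
Qed.

Lemma fps1_neq0 : fps1 != fps0.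
Proof.
by apply/eqP => /fpsP/(_ mset0)/eqP; rewrite /= eqxx oner_eq0.
Qed.

HB.instance Definition _ :=
  GRing.Zmodule_isComNzRing.Build S fpsMA fpsMC fps1M fpsMDl fps1_neq0.

Lemma fpsZA a b f : fpsZ a (fpsZ b f) = fpsZ (a * b) f.
Proof. by apply/fpsP => m /=; rewrite mulrA. Qed.
Lemma fps1Z : left_id 1 fpsZ.
Proof. by move=> f; apply/fpsP => m /=; rewrite mul1r. Qed.
Lemma fpsZDr : right_distributive fpsZ +%R.
Proof. by move=> a f g; apply/fpsP => m /=; rewrite mulrDr. Qed.
Lemma fpsZDl f : {morph fpsZ^~ f : a b / a + b}.
Proof. by move=> a b; apply/fpsP => m /=; rewrite mulrDl. Qed.

HB.instance Definition _ :=
  GRing.Zmodule_isLmodule.Build K S fpsZA fps1Z fpsZDr fpsZDl.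

Lemma fpsZAl a f g : a *: (f * g) = (a *: f) * g.
Proof.
apply/fpsP => m; transitivity (a * fpsM f g m); first by [].
rewrite [RHS]fpsME0 fpsME0 mulr_sumr.
apply: eq_bigr => d _; rewrite mulr_sumr.
by apply: eq_bigr => e _; rewrite mulrA.
Qed.

HB.instance Definition _ := GRing.Lmodule_isLalgebra.Build K S fpsZAl.
HB.instance Definition _ := GRing.Lalgebra_isComAlgebra.Build K S.

Definition fpsX (i : I) : S := Fps (fun m => (m == [mset i])%:R).

End Ring.

Arguments coef : simpl never.

Section CoefTheory.
Variables (K : comNzRingType) (I : choiceType).
Implicit Types (f g h : fps K I) (m d e : {mset I}).

Lemma coefD f g m : (f + g) m = f m + g m. Proof. by []. Qed.
Lemma coefN f m : (- f) m = - f m. Proof. by []. Qed.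
Lemma coefZ c f m : (c *: f) m = c * f m. Proof. by []. Qed.
Lemma coef1 m : (1 : fps K I) m = (m == mset0)%:R. Proof. by []. Qed.
Lemma coefX i m : fpsX K i m = (m == [mset i])%:R. Proof. by []. Qed.

Lemma coefM f g m : (f * g) m = \sum_(d <- mdivisors m) f d * g (m `\` d).
Proof.
rewrite [LHS]fpsME0; apply: eq_big_seq => d; rewrite in_mdivisors => dm.
have dK : d `+` (m `\` d) = m.
  by apply/msetP => x; rewrite !msetE2 subnKC//; move/msubsetP: dm.
have em : m `\` d \in mdivisors m by rewrite in_mdivisors -[X in _ `<=` X]dK msub_Dr.
rewrite big_mkcond (big_fsetD1 _ em)/= dK eqxx big1_fset ?addr0// => e.
rewrite !inE => /andP[ne _] _; case: eqP => // de; case/eqP: ne.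
by apply/msetP => x; rewrite -de !msetE2 addKn.
Qed.

Lemma coefXM i g m : (fpsX K i * g) m = if i \in m then g (m `\ i) else 0.
Proof.
rewrite coefM; case: ifPn => im.
  have mi : [mset i] \in mdivisors m.
    by rewrite in_mdivisors msub1set.
  rewrite (big_fsetD1 _ mi)/= coefX eqxx mul1r big1_fset ?addr0// => d.
  by rewrite !inE coefX => /andP[/negbTE -> _] _; rewrite mul0r.
rewrite big_seq big1// => d; rewrite in_mdivisors coefX => dm /=.
case: eqP => [di|]; rewrite ?mul0r//; case/negP: im.
by rewrite di msub1set in dm.
Qed.

Lemma coef_sum J (r : seq J) (P : pred J) (F : J -> fps K I) m :
  (\sum_(i <- r | P i) F i) m = \sum_(i <- r | P i) F i m.
Proof.
by elim/big_rec2: _ => // i x y _ <-.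
Qed.
End CoefTheory.

Lemma size_msetB1 (I : choiceType) (m : {mset I}) i :
  i \in m -> size m = (size (m `\ i)).+1.
Proof.
move=> im; have /perm_size -> : perm_eq m (i :: m `\ i); last by [].
apply/allP => x _; apply/eqP => /=.
by rewrite !count_mem_mset -[in LHS](msetB1K im) mset1DE eq_sym.
Qed.

(* The geometric series 1 / (1 - c u) in K[[u]], see geomE. *)
Definition geom (K : comNzRingType) (c : K) : fps K unit :=
  Fps (fun m => c ^+ size m).

Lemma coef_geom (K : comNzRingType) (c : K) m : geom c m = c ^+ size m.
Proof. by []. Qed.

Lemma geomE (K : comNzRingType) (c : K) :
  (1 - c *: fpsX K tt) * geom c = 1.
Proof.
apply/fpsP => m; rewrite mulrBl mul1r -scalerAl coefD coefN coefZ coefXM coef1.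
case: (m =P mset0) => [->|m0].
  by rewrite in_mset0 mulr0 subr0 coef_geom ?eqxx enum_mset0 expr0.
have im : tt \in m.
  apply: contra_notT m0 => tm; apply/msetP => -[]; rewrite mset0E.
  exact/mset_eq0P.
by rewrite im !coef_geom (size_msetB1 im) exprS subrr.
Qed.

Section Symmetric.
Variable K : comNzRingType.
Local Notation S := (fps K nat).
Implicit Type t : K.

(* The indeterminates x_1, x_2, ... are indexed from 0: fpsX K i
   is x_(i+1). *)

Definition bounded_degree (f : S) :=
  exists d, forall m : {mset nat}, (d < size m)%N -> f m = 0.

(* The monomial \prod_a x_(i a) ^ (k a). *)
Definition monom p (i k : 'I_p -> nat) : {mset nat} :=
  seq_mset (flatten [seq nseq (k a) (i a) | a <- enum 'I_p]).

Definition QSym : set S := [set f | bounded_degree f /\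
  forall p (i k : 'I_p -> nat), {homo i : a b / (a < b)%N} ->
    (forall a, (0 < k a)%N) -> f (monom i k) = f (monom (@nat_of_ord p) k)].

Definition Lambda : set S := [set f | bounded_degree f /\
  forall w : nat -> nat, bijective w ->
    forall m : {mset nat}, f (seq_mset (map w m)) = f m].

Definition hsym n : S := Fps (fun m => (size m == n)%:R).

(* The limit of an eventually constant sequence. *)
Definition evlim (u : nat -> K) : K :=
  xget 0 [set l | exists N, forall n, (N <= n)%N -> u n = l].

(* (1 - x_i t u) / (1 - x_i u), in the ring S[[u]]. *)
Definition qn_factor t (i : nat) : fps S unit :=
  (1 - (t *: fpsX K i) *: fpsX S tt) * geom (fpsX K i).

(* The coefficient of u^n in the infinite product of the factors. The product
   is the coefficientwise limit of the partial products, each coefficient of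
   which is eventually constant by qn_stable. *)
Definition qn t (n : nat) : S :=
  Fps (fun m => evlim (fun N => (\prod_(i < N) qn_factor t i) (msetn n tt) m)).

Arguments qn_factor : simpl never.

Lemma qn_factor0 t i : qn_factor t i mset0 = 1.
Proof.
rewrite /qn_factor mulrBl mul1r -scalerAl coefD coefN coefZ coefXM.
by rewrite in_mset0 mulr0 subr0 coef_geom ?eqxx enum_mset0 expr0.
Qed.

Lemma qn_factorS t i (d : {mset unit}) : d != mset0 ->
  qn_factor t i d = (1 - t) *: fpsX K i ^+ size d.
Proof.
move=> d0; have id : tt \in d.
  apply: contraNT d0 => tm; apply/eqP/msetP => -[]; rewrite mset0E.
  exact/mset_eq0P.
rewrite /qn_factor mulrBl mul1r -scalerAl coefD coefN coefZ coefXM id !coef_geom.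
by rewrite (size_msetB1 id) exprS -scalerAl scalerBl scale1r.
Qed.

Lemma qn_stable t n (m : {mset nat}) N :
  (forall i, i \in m -> (i < N)%N) ->
  (\prod_(i < N) qn_factor t i) (msetn n tt) m = qn t n m.
Proof.
move=> mN; set u := fun N => (\prod_(i < N) qn_factor t i) (msetn n tt) m.
have uS M : (N <= M)%N -> u M = u N.
  elim: M => [|M IH]; first by rewrite leqn0 => /eqP ->.
  rewrite leq_eqVlt => /orP[/eqP <-//|]; rewrite ltnS => NM.
  rewrite -(IH NM) /u big_ord_recr coefM/= coef_sum.
  have nn : msetn n tt \in mdivisors (msetn n tt) by rewrite in_mdivisors msubset_refl.
  rewrite (big_fsetD1 _ nn)/= [X in _ + X]big1_fset ?addr0.
    have -> : msetn n tt `\` msetn n tt = mset0.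
      by apply/msetP => x; rewrite msetE2 subnn mset0E.
    by rewrite qn_factor0 mulr1.
  move=> d; rewrite !inE in_mdivisors => /andP[dn dm] _.
  rewrite qn_factorS.
    rewrite -scalerAr coefZ; set k := size _.
    have -> : k = k.-1.+1.
      rewrite prednK// lt0n size_eq0; apply: contra dn => /eqP e.
      rewrite eqEmsubset dm; apply/msubsetP => x.
      have := count_mem_mset x (msetn n tt `\` d).
      by rewrite e/= msetE2 => /esym/eqP; rewrite subn_eq0.
    rewrite exprS mulrCA coefXM ifF ?mulr0//.
    by apply/negP => /mN; rewrite ltnNge NM.
  apply: contra dn => /eqP/msetP e; rewrite eqEmsubset dm; apply/msubsetP => x.
  by have /eqP := e x; rewrite msetE2 mset0E subn_eq0.
have [M Ml] := xgetPex 0 (ex_intro (fun l => exists N, forall n, (N <= n)%N -> u n = l)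
  (u N) (ex_intro _ N uS)).
by rewrite -[LHS]/(u N) -(uS (maxn M N)) ?leq_maxr// Ml// leq_maxl.
Qed.


Definition lspan (A : set S) : set S :=
  smallest (fun V : set S => submod_closed (mem V)) A.

Definition subalg_gen (A : set S) : set S :=
  smallest (fun V : set S => subalg_closed (mem V)) A.

Definition Lambda_t t : set S := subalg_gen (range (qn t)).

(* phi restricts to a homomorphism of K-algebras from the subalgebra A to the
   subalgebra B; its values outside A are irrelevant. *)
Definition is_alg_hom (A B : set S) (phi : S -> S) :=
  [/\ subalg_closed (mem A), subalg_closed (mem B), {homo phi : f / A f >-> B f},
      forall c, {in A &, forall f g, phi (c *: f + g) = c *: phi f + phi g}
    & phi 1 = 1 /\ {in A &, {morph phi : f g / f * g}}].

Definition is_theta t (phi : S -> S) :=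
  is_alg_hom Lambda (Lambda_t t) phi /\ forall n, phi (hsym n) = qn t n.

(* Lambda is freely generated by hsym 1, hsym 2, ..., so is_theta t determines
   a map on Lambda. The default value 0 is not a homomorphism: a map that is
   multiplicative and unital on Lambda and agrees there with theta t can only
   do so because some phi satisfies is_theta t. *)
Definition theta t : S -> S := xget (fun=> 0) (is_theta t).

End Symmetric.

(* The nonzero integers, ordered by -1 < 1 < -2 < 2 < ...: the pair (k, b)
   stands for k + 1 if b is true and for - (k + 1) if b is false. *)
Definition Ppm := (nat *l bool)%type.
Definition is_neg (a : Ppm) := ~~ a.2.

Section Fundamental.
Variable K : comNzRingType.
Local Notation S := (fps K nat).

(* lt is the strict order i <_P j of the labelled poset P. *)
Definition enriched n (lt : rel 'I_n) : set {ffun 'I_n -> Ppm} :=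
  [set f | forall i j, lt i j ->
    [/\ (i < j)%N -> (f i < f j)%O \/ f i = f j /\ ~~ is_neg (f i)
      & (j < i)%N -> (f i < f j)%O \/ f i = f j /\ is_neg (f i)]].

(* The infinite sum over f is taken coefficientwise, with finitely many nonzero
   terms in each coefficient by finite_Gamma; (f i).1 is the index, counted
   from 0, of x_|f(i)|. *)
Definition Gamma n (q : K) (lt : rel 'I_n) : S := Fps (fun m =>
  \sum_(f \in enriched lt) (\prod_i (q ^+ is_neg (f i) *: fpsX K (f i).1)) m).

Definition Lperm n (q : K) (p : 'S_n) : S :=
  Gamma q (fun a b => (p^-1%g a < p^-1%g b)%N).

(* The element i of 'I_n.-1 stands for the descent position i + 1. *)
Definition Des n (p : 'S_n) : {set 'I_n.-1} :=
  [set i : 'I_n.-1 | [exists a : 'I_n, exists b : 'I_n,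
    [&& a == i :> nat, b == i.+1 :> nat & (p b < p a)%N]]]%SET.

(* Some p with Des p = I exists by Des_surj; any such p gives the same series
   by L_Des. *)
Definition L (q : K) n (I : {set 'I_n.-1}) : S :=
  if [pick p : 'S_n | Des p == I] is Some p then Lperm q p else 0.

Definition Pq (q : K) : set S :=
  lspan [set f | exists n (I : {set 'I_n.-1}), f = L q I].

Lemma finite_Gamma n (q : K) (lt : rel 'I_n) (m : {mset nat}) :
  finite_set (enriched lt `&` [set f |
    (\prod_i (q ^+ is_neg (f i) *: fpsX K (f i).1)) m != 0]).
Proof.
pose N := (\max_(i <- m) i).+1.
pose h (s : {ffun 'I_n -> 'I_N * bool}) : {ffun 'I_n -> Ppm} :=
  [ffun i => ((s i).1 : nat, (s i).2)].
apply: (@sub_finite_set _ _ [set h s | s in setT]); last exact: finite_image.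
move=> f [_ /= fm].
have fN i : ((f i).1 < N)%N.
  rewrite ltnS; apply: leq_bigmax_seq => //.
  apply: contraNT fm => fi; rewrite (bigD1 i)//= -scalerAl coefZ coefXM ifN//.
  by rewrite mulr0.
exists [ffun i => (inord (f i).1, (f i).2)] => //.
by apply/ffunP => i; rewrite !ffunE /= inordK//; case: (f i).
Qed.

Lemma coef_Gamma n (q : K) (lt : rel 'I_n) m : Gamma q lt m =
  \sum_(f \in enriched lt) (\prod_i (q ^+ is_neg (f i) *: fpsX K (f i).1)) m.
Proof. by []. Qed.

Lemma enriched_permP n (p : 'S_n) (f : {ffun 'I_n -> Ppm}) :
  enriched (fun a b => (p^-1%g a < p^-1%g b)%N) f <->
  forall a b : 'I_n, b = a.+1 :> nat ->
    (f (p a) < f (p b))%O \/ f (p a) = f (p b) /\ is_neg (f (p a)) = (p b < p a)%N.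
Proof.
split=> [ef a b ba|H i j].
  have /ef[] : (p^-1%g (p a) < p^-1%g (p b))%N by rewrite !permK ba.
  case: (ltngtP (p a) (p b)) => [ab|ab|/val_inj/perm_inj ab].
  - by move=> /(_ isT)[fab|[fab /negbTE nf]] _; [left|right].
  - by move=> _ /(_ isT)[fab|[fab nf]]; [left|right].
  - by move: ba; rewrite ab => /n_Sn.
have K' : forall d (a b : 'I_n), b = (a + d.+1)%N :> nat ->
    (f (p a) < f (p b))%O \/ f (p a) = f (p b) /\ is_neg (f (p a)) = (p b < p a)%N.
  elim=> [|d IH] a b bE; first by apply: H; rewrite bE addn1.
  have cn : (a + d.+1 < n)%N by rewrite (leq_ltn_trans _ (ltn_ord b))// bE leq_add2l.
  have := IH a (Ordinal cn) erefl; have := H (Ordinal cn) b.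
  rewrite /= bE addnS => /(_ erefl); set c := Ordinal cn.
  move=> [cb|[cb1 cb2]] [ac|[ac1 ac2]].
  - by left; apply: lt_trans ac cb.
  - by left; rewrite ac1.
  - by left; rewrite -cb1.
  right; split; first by rewrite ac1.
  move: cb2; rewrite -ac1 ac2 => cb2; have [ca|ca|ca] := ltngtP (p c) (p a).
  + by move: cb2; rewrite ca => /esym bc; rewrite (ltn_trans bc ca).
  + move: cb2; rewrite ltnNge (ltnW ca) => /esym/negbT; rewrite -leqNgt => bc.
    by apply/esym/negbTE; rewrite -leqNgt (leq_trans (ltnW ca)).
  + move/val_inj/perm_inj/(congr1 val): ca => /= /eqP.
    by rewrite -[X in _ == X]addn0 eqn_add2l.
move=> ij; set a := p^-1%g i in ij *; set b := p^-1%g j in ij *.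
have bE : b = (a + (b - a.+1).+1)%N :> nat by rewrite addnS -addSn subnKC.
have [-> ->] : i = p a /\ j = p b by rewrite !permKV.
case: (K' _ _ _ bE) => {bE} [fij|[fij nf]]; first by split=> _; left.
split=> hij; right; split=> //; rewrite nf ?hij//.
by rewrite -leqNgt ltnW.
Qed.

Lemma Lperm_Des n (q : K) (p p' : 'S_n) : Des p = Des p' ->
  Lperm q p = Lperm q p'.
Proof.
move=> dpp'.
have dE (s : 'S_n) (a b : 'I_n) (k : 'I_n.-1) : k = a :> nat -> b = a.+1 :> nat ->
    (s b < s a)%N = (k \in Des s).
  move=> ka ba; rewrite inE; apply/idP/existsP => [sba|[x /existsP[y]]].
    by exists a; apply/existsP; exists b; rewrite ka ba !eqxx.
  move=> /and3P[/eqP xk /eqP yk].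
  have -> : a = x by apply/val_inj; rewrite /= xk ka.
  by have -> : b = y by apply/val_inj; rewrite /= ba yk ka.
have dd (a b : 'I_n) : b = a.+1 :> nat -> (p b < p a)%N = (p' b < p' a)%N.
  move=> ba; have kn : (a < n.-1)%N by rewrite -ltnS -ba prednK ?(leq_ltn_trans _ (ltn_ord b)).
  by rewrite !(dE _ a b (Ordinal kn))// dpp'.
pose h (s s' : 'S_n) (f : {ffun 'I_n -> Ppm}) : {ffun 'I_n -> Ppm} :=
  [ffun a => f (s (s'^-1%g a))].
have hK (s s' : 'S_n) : cancel (h s s') (h s' s).
  by move=> f; apply/ffunP => a; rewrite !ffunE !permK permKV.
have hE (s s' : 'S_n) f : (forall a b : 'I_n, b = a.+1 :> nat ->
      (s b < s a)%N = (s' b < s' a)%N) ->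
    enriched (fun a b => (s^-1%g a < s^-1%g b)%N) f ->
    enriched (fun a b => (s'^-1%g a < s'^-1%g b)%N) (h s s' f).
  move=> ss' /enriched_permP ef; apply/enriched_permP => a b ba.
  by rewrite !ffunE !permK -ss'//; apply: ef.
apply/fpsP => m; apply/esym; rewrite !coef_Gamma.
rewrite (reindex_fsbig (h p p') (enriched (fun a b => (p^-1%g a < p^-1%g b)%N))).
  apply: eq_fsbigr => f _.
  rewrite [in RHS](reindex_inj (@perm_inj _ (p'^-1 * p)%g)).
  apply: (congr1 (fun F : fps K nat => F m)); apply: eq_bigr => a _.
  by rewrite !ffunE permM.
split=> [f|f g _ _|f ef].
- exact: hE.
- exact: can_inj (hK p p') f g.
- by exists (h p' p f); [apply: hE => // a b /dd|rewrite hK].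
Qed.

Lemma Des_surj n (I : {set 'I_n.-1}) : exists p : 'S_n, Des p = I.
Proof.
pose b (i : 'I_n) := #|[set k : 'I_n.-1 | (k \notin I) && (k < i)%N]%SET|.
pose key (i : 'I_n) := (b i * n + (n - i.+1))%N.
have key_inj : injective key.
  move=> i j /(congr1 (modn^~ n)); rewrite !modnMDl !modn_small.
  - move=> e; apply/val_inj/eqP; have := ltn_ord i; have := ltn_ord j => hj hi.
    by rewrite -eqSS -(eqn_add2l (n - i.+1)) subnK// e subnK.
  - by rewrite ltn_subrL (leq_ltn_trans _ (ltn_ord j)).
  - by rewrite ltn_subrL (leq_ltn_trans _ (ltn_ord i)).
pose rk (i : 'I_n) := #|[set j : 'I_n | (key j < key i)%N]%SET|.
have rkn i : (rk i < n)%N.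
  rewrite -[X in (_ < X)%N]card_ord; apply/proper_card/properP; split.
    exact: subset_predT.
  by exists i => //; rewrite inE ltnn.
have rk_lt i j : (key i < key j)%N -> (rk i < rk j)%N.
  move=> ij; apply/proper_card/properP; split.
    by apply/fintype.subsetP => k; rewrite !inE => /ltn_trans; apply.
  by exists i; rewrite !inE ?ltnn.
pose f i := Ordinal (rkn i).
have f_inj : injective f.
  move=> i j [rij]; apply: key_inj; case: (ltngtP (key i) (key j)) => // /rk_lt.
    by rewrite rij ltnn.
  by rewrite rij ltnn.
have fE i j : (f i < f j)%N = (key i < key j)%N.
  apply/idP/idP => [|/rk_lt//]; apply: contraTT; rewrite -!leqNgt leq_eqVlt.
  by case/orP => [/eqP/key_inj ->//|/rk_lt/ltnW].
exists (perm f_inj); apply/setP => k; rewrite inE.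
have kn : (k.+1 < n)%N by have := ltn_ord k; rewrite -ltnS prednK// lt0n; case: (n) (k) => // -[].
have keyE : (key (Ordinal kn) < key (Ordinal (ltnW kn)))%N = (k \in I).
  rewrite /key /b /=; have [kI|kI] := boolP (k \in I).
    rewrite (_ : [set _ | _ & _]%SET = [set k0 : 'I_n.-1 | (k0 \notin I) && (k0 < k)%N]%SET).
      by rewrite ltn_add2l ltn_sub2l.
    apply/setP => x; rewrite !inE ltnS leq_eqVlt; case: (x \notin I) / idP => //= xI.
    by case: eqP => //= /val_inj xk; move: xI; rewrite xk kI.
  rewrite (_ : [set _ | _ & _]%SET = (k |: [set k0 : 'I_n.-1 | (k0 \notin I) && (k0 < k)%N])%SET).
    rewrite cardsU1 !inE ltnn andbF/= add1n mulSn; apply/negbTE; rewrite -leqNgt.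
    rewrite -addnA addnCA leq_add2l (leq_trans (leq_subr _ _))// leq_addr//.
  apply/setP => x; rewrite !inE ltnS leq_eqVlt -val_eqE /=.
  by case: eqP => [/val_inj ->|_] //=; rewrite kI.
apply/idP/idP => [/existsP[x /existsP[y /and3P[/eqP xk /eqP yk]]]|kI].
  have -> : x = Ordinal (ltnW kn) by apply/val_inj.
  have -> : y = Ordinal kn by apply/val_inj.
  by rewrite !permE fE keyE.
apply/existsP; exists (Ordinal (ltnW kn)); apply/existsP; exists (Ordinal kn).
by rewrite !eqxx/= !permE fE keyE.
Qed.

Lemma L_Des n (q : K) (p : 'S_n) : L q (Des p) = Lperm q p.
Proof.
rewrite /L; case: pickP => [p' /eqP|/(_ p)]; last by rewrite eqxx.
exact: Lperm_Des.
Qed.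

Lemma L_0 (q : K) (I : {set 'I_0.-1}) : L q I = 1.
Proof.
have [p <-] := Des_surj I; rewrite L_Des; apply/fpsP => m.
rewrite coef_Gamma (_ : enriched _ = [set [ffun i => (0%N, true)]]).
  by rewrite fsbig_set1 big_ord0.
apply/seteqP; split => [f _ /=|f _]; first by apply/ffunP => -[].
by case.
Qed.
End Fundamental.

(* Main.v *)
Require Import Defs.
From HB Require Import structures.
From mathcomp Require Import all_boot all_order all_algebra all_fingroup.
From mathcomp Require Import finmap multiset.
From mathcomp Require Import classical_sets boolp functions cardinality fsbigop.
From mathcomp Require Import reals complex.

(* The product of two series L q I and L q I' is a sum of series L q J over the
   shuffles of two permutations with descent sets I and I'; the index set does not
   depend on q. As the L 0 I span QSym, the linear map Theta sending L 0 I to L q I is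
   therefore multiplicative. It sends h_n = L 0 set0 to L q set0, whose coefficients
   are (1 + q) ^ (number of variables), that is, to q_n(X; -q); the h_n generate
   Lambda as an algebra (Newton's identities), so Theta restricts to theta. *)

Set Implicit Arguments.
Unset Strict Implicit.
Unset Printing Implicit Defensive.

Import Order.TTheory GRing.Theory.

Local Open Scope mset_scope.
Local Open Scope ring_scope.

(** * Shuffle products *)

Section Standardization.
Variable n : nat.
Implicit Types (h : 'I_n -> Ppm) (p : 'S_n) (r : rel 'I_n).

(** Coefficients of [Lperm] are sums over infinitely many maps, so the shuffle rule cannot be
    obtained by directly multiplying out sums. It is proved with finitely many letters and carried
    over one coefficient at a time, since a coefficient of a product involves only the variables of
    its monomial. At [q = 0] the series are Gessel's fundamental quasisymmetric functions. Their
    span is all of [QSym], so that closure of [QSym] under products is itself an instance of the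
    shuffle rule. The map [theta] is a choice among the maps satisfying [is_theta], with a default
    value if there were none. Existence is witnessed by [Theta] itself; agreement then follows
    because two homomorphisms that coincide on the generators h_n coincide on [Lambda].
    Characteristic zero enters in one place: the proof that the h_n generate divides by the number
    of variables of a monomial. *)

Lemma perm_of_order r : irreflexive r -> transitive r ->
    (forall i j, i != j -> r i j || r j i) ->
  exists p, forall i j, (p^-1%g i < p^-1%g j)%N = r i j.
Proof.
move=> rI rT rt; pose rk i := #|[set j | r j i]%SET|.
have rkn i : (rk i < n)%N.
  rewrite -[X in (_ < X)%N]card_ord; apply/proper_card/properP; split.
    exact: subset_predT.
  by exists i => //; rewrite inE rI.
have rk_lt i j : r i j -> (rk i < rk j)%N.
  move=> ij; apply/proper_card/properP; split.
    by apply/fintype.subsetP => k; rewrite !inE => /rT; apply.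
  by exists i; rewrite !inE ?rI.
pose f i := Ordinal (rkn i).
have f_inj : injective f.
  move=> i j [rij]; apply/eqP; apply: contraT => /rt /orP[] /rk_lt;
  by rewrite rij ltnn.
(* The order is read through [p^-1], so [p] has to be the inverse of the rank function. *)
exists (perm f_inj)^-1%g => i j; rewrite invgK !permE /=.
apply/idP/idP => [|/rk_lt//]; apply: contraTT => rij; rewrite -leqNgt.
by have [->//|/rt] := eqVneq i j; rewrite (negbTE rij) => /rk_lt/ltnW.
Qed.

Lemma card_ord_lt m : (m <= n)%N -> #|[set k : 'I_n | (k < m)%N]%SET| = m.
Proof.
move=> mn; rewrite -[RHS]card_ord -[RHS](card_codom (f := widen_ord mn)).
  apply: eq_card => k; rewrite inE; apply/idP/codomP => [km|[x ->]]; last exact: (ltn_ord x).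
  by exists (Ordinal km); apply/val_inj.
by move=> x y [xy]; apply/val_inj.
Qed.

(** The position [p^-1 i] is the number of labels that come before [i], hence determined by the
    order. *)
Lemma perm_order_inj (p p' : 'S_n) :
  (forall i j, (p^-1%g i < p^-1%g j)%N = (p'^-1%g i < p'^-1%g j)%N) -> p = p'.
Proof.
move=> pp'.
have rk (s : 'S_n) i : #|[set j | s^-1%g j < s^-1%g i]%SET|%N = s^-1%g i.
  rewrite -(card_imset _ (@perm_inj _ (s^-1)%g)) -[RHS](card_ord_lt (ltnW (ltn_ord _))).
  apply: eq_card => k; rewrite inE; apply/imsetP/idP => [[j + ->]|ki]; first by rewrite inE.
  by exists (s k); rewrite ?inE permK.
apply: invg_inj; apply/permP => i; apply/val_inj; rewrite /= -(rk p) -(rk p').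
by apply: eq_card => j; rewrite !inE pp'.
Qed.

(* An enriched P-partition of a chain determines that chain: positions are sorted
   by value, ties by label, increasingly on a positive value and decreasingly on
   a negative one. *)
Definition plt h (i j : 'I_n) : bool :=
  (h i < h j)%O || (h i == h j) && (if is_neg (h i) then j < i else i < j)%N.

Lemma plt_irr h : irreflexive (plt h).
Proof. by move=> i; rewrite /plt ltxx eqxx /= ltnn; case: ifP. Qed.

Lemma plt_trans h : transitive (plt h).
Proof.
move=> j i k /orP[ij|/andP[/eqP ij cij]] /orP[jk|/andP[/eqP jk cjk]].
- by rewrite /plt (lt_trans ij jk).
- by rewrite /plt -jk ij.
- by rewrite /plt ij jk.
rewrite /plt -jk -ij eqxx ltxx /=; move: cij cjk; rewrite -ij.
by case: ifP => _ => [a b|]; [apply: ltn_trans b a|apply: ltn_trans].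
Qed.

Lemma plt_total h i j : i != j -> plt h i j || plt h j i.
Proof.
move=> ij; rewrite /plt; case: (ltgtP (h i) (h j)) => //= <-.
by case: ifP => _; move: ij; rewrite -val_eqE neq_ltn // orbC.
Qed.

Lemma plt_perm h : exists p, forall i j, (p^-1%g i < p^-1%g j)%N = plt h i j.
Proof.
by apply: perm_of_order; [apply: plt_irr|apply: plt_trans|apply: plt_total].
Qed.

Lemma enriched_plt r (f : {ffun 'I_n -> Ppm}) : irreflexive r ->
  enriched r f <-> forall i j, r i j -> plt f i j.
Proof.
move=> rI; split=> H i j rij.
  have [H1 H2] := H _ _ rij; rewrite /plt.
  case: (ltngtP i j) => ij.
  - by have [->//|[-> /negbTE ->]] := H1 ij; rewrite eqxx orbT.
  - by have [->//|[-> ->]] := H2 ij; rewrite eqxx orbT.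
  - by move: rij; rewrite (val_inj ij) rI.
have := H _ _ rij; rewrite /plt => /orP[->|/andP[/eqP -> +]]; first by split; left.
by case: ifP => nf ij; split=> ij'; rewrite ?nf; first [by right|by rewrite ltnNge (ltnW ij) in ij'].
Qed.

(** Both relations are strict total orders, and an inclusion between two such orders is an
    equality. *)
Lemma enriched_perm_plt p (f : {ffun 'I_n -> Ppm}) :
  enriched (fun a b => (p^-1%g a < p^-1%g b)%N) f <->
  forall i j, (p^-1%g i < p^-1%g j)%N = plt f i j.
Proof.
rewrite enriched_plt; last by move=> i; rewrite ltnn.
split=> [H i j|H i j]; last by rewrite H.
apply/idP/idP => [/H//|]; apply: contraTT => pij.
have [->|ij] := eqVneq i j; first by rewrite plt_irr.
have /H ji : (p^-1%g j < p^-1%g i)%N.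
  rewrite ltn_neqAle leqNgt pij andbT.
  by rewrite val_eqE (inj_eq perm_inj) eq_sym.
by apply/negP => /(plt_trans ji); rewrite plt_irr.
Qed.

End Standardization.

Section Truncation.
Variables (K : comNzRingType) (q : K).

Lemma coef_prodX (T : Type) (r : seq T) (c : T -> K) (j : T -> nat) m :
  (\prod_(i <- r) (c i *: fpsX K (j i))) m =
  (\prod_(i <- r) c i) * (m == seq_mset (map j r))%:R.
Proof.
elim: r m => [|x r IH] m /=.
  rewrite !big_nil mul1r Defs.coef1; congr (_ == _)%:R.
  by apply/msetP => x; rewrite mset0E mset_seqE.
rewrite !big_cons -scalerAl Defs.coefZ Defs.coefXM IH -mulrA; congr (_ * _).
rewrite mset_cons; case: ifPn => [jm|jm].
  congr (_ * (nat_of_bool _)%:R); apply/eqP/eqP => [mj|->]; last by rewrite msetD1K.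
  by rewrite -mj msetB1K.
rewrite (_ : _ == _ = false) ?mulr0//; apply/negbTE; apply: contraNneq jm => ->.
exact: mset1D1.
Qed.

Variable B : nat.
Local Notation letters n := {ffun 'I_n -> 'I_B * bool}.

Definition pletter n (h : letters n) (i : 'I_n) : Ppm := ((h i).1 : nat, (h i).2).

Definition wt n (h : letters n) : fps K nat :=
  \prod_i (q ^+ (~~ (h i).2) *: fpsX K (val (h i).1)).

Definition compat n (p : 'S_n) (h : letters n) : bool :=
  [forall i, forall j, (p^-1%g i < p^-1%g j)%N == plt (pletter h) i j].

Lemma compatP n (p : 'S_n) (h : letters n) :
  reflect (forall i j, (p^-1%g i < p^-1%g j)%N = plt (pletter h) i j) (compat p h).
Proof.
by apply: (iffP 'forall_'forall_eqP).
Qed.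

Definition Ltrunc n (p : 'S_n) : fps K nat := \sum_(h : letters n | compat p h) wt h.

(* Letters of absolute value at most B suffice for a fixed monomial, which turns
   the sum over all enriched partitions into a finite one. *)
Lemma Lperm_trunc n (p : 'S_n) (m : {mset nat}) :
  (forall i, i \in m -> (i < B)%N) -> Lperm q p m = Ltrunc p m.
Proof.
move=> mB; pose F (h : letters n) : {ffun 'I_n -> Ppm} := [ffun i => pletter h i].
have F_inj : injective F.
  move=> h h' /ffunP hh'; apply/ffunP => i; have := hh' i; rewrite !ffunE /pletter.
  case: (h i) (h' i) => [a b] [a' b'] [ab ->] /=; congr pair; exact/val_inj.
have FE h : compat p h <-> enriched (fun a b => (p^-1%g a < p^-1%g b)%N) (F h).
  rewrite enriched_perm_plt; split => [/compatP H i j|H].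
    by rewrite H /plt !ffunE.
  by apply/compatP => i j; rewrite H /plt !ffunE.
rewrite /Lperm coef_Gamma (fsbigE [seq F h | h <- enum [pred h | compat p h]]).
- rewrite big_map big_enum_cond /Ltrunc Defs.coef_sum; apply: eq_big => [h|h _].
    by rewrite !inE; apply/andb_idr => /FE hE; rewrite inE.
  apply: (congr1 (fun G : fps K nat => G m)); apply: eq_bigr => i _.
  by rewrite !ffunE.
- rewrite map_inj_in_uniq ?enum_uniq// => h h' _ _; exact: F_inj.
- by move=> _ /= /mapP[h + ->]; rewrite mem_enum inE => /FE.
move=> f ef nf; rewrite coef_prodX; case: eqP => [mf|]; rewrite ?mulr0//.
case/negP: nf.
have fB i : ((f i).1 < B)%N.
  by apply: mB; rewrite mf in_mset mset_seqE -has_count has_pred1; apply/map_f; rewrite mem_index_enum.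
pose h : letters n := [ffun i => (Ordinal (fB i), (f i).2)].
have hf : F h = f.
  by apply/ffunP => i; rewrite !ffunE /pletter ffunE [RHS]surjective_pairing.
apply/mapP; exists h => //.
by rewrite mem_enum inE; apply/FE; rewrite hf.
Qed.


(** Read as a word, [t] is a shuffle of the word of [p1] with the word of [p2] shifted up by [n1];
    inverses give the positions of letters. *)
Definition shuffle_perm n1 n2 (p1 : 'S_n1) (p2 : 'S_n2) (t : 'S_(n1 + n2)) :=
  [forall i, forall j, (p1^-1%g i < p1^-1%g j)%N ==
     (t^-1%g (lshift n2 i) < t^-1%g (lshift n2 j))%N] &&
  [forall i, forall j, (p2^-1%g i < p2^-1%g j)%N ==
     (t^-1%g (rshift n1 i) < t^-1%g (rshift n1 j))%N].

(* Both sides enumerate the pairs of enriched partitions: glued together, such a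
   pair is enriched for exactly one permutation, and this one is a shuffle. *)
Lemma Ltrunc_mul n1 n2 (p1 : 'S_n1) (p2 : 'S_n2) :
  Ltrunc p1 * Ltrunc p2 = \sum_(t | shuffle_perm p1 p2 t) Ltrunc t.
Proof.
pose l (h : letters (n1 + n2)) : letters n1 := [ffun i => h (lshift n2 i)].
pose r (h : letters (n1 + n2)) : letters n2 := [ffun i => h (rshift n1 i)].
pose g (u : letters n1 * letters n2) : letters (n1 + n2) :=
  [ffun i : 'I_(n1 + n2) => match fintype.split i with inl a => u.1 a | inr b => u.2 b end].
have lrK : cancel (fun h => (l h, r h)) g.
  move=> h; apply/ffunP => i; rewrite ffunE /=.
  by case: fintype.splitP => a ia; rewrite ffunE; congr (h _); apply/val_inj.
have gK : cancel g (fun h => (l h, r h)).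
  move=> [u1 u2]; congr pair; apply/ffunP => i; rewrite !ffunE.
    by rewrite (unsplitK (inl i)).
  by rewrite (unsplitK (inr i)).
have lrE (F : 'I_B * bool -> fps K nat) h :
    (\prod_i F (l h i)) * (\prod_i F (r h i)) = \prod_i F (h i).
  rewrite [RHS]big_split_ord; congr (_ * _); by apply: eq_bigr => i _; rewrite ffunE.
have wtE h : wt (l h) * wt (r h) = wt h.
  exact: (lrE (fun a => q ^+ (~~ a.2) *: fpsX K (val a.1))).
have pl h i j : plt (pletter (l h)) i j = plt (pletter h) (lshift n2 i) (lshift n2 j).
  by rewrite /plt /pletter !ffunE.
have pr h i j : plt (pletter (r h)) i j = plt (pletter h) (rshift n1 i) (rshift n1 j).
  by rewrite /plt /pletter !ffunE /= !ltn_add2l.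
rewrite /Ltrunc big_distrlr pair_big /=.
rewrite (reindex (fun h => (l h, r h))) /=; last by exists g => ? _.
under eq_bigr do rewrite wtE.
rewrite (exchange_big_dep predT) //= big_mkcond /=; apply: eq_bigr => h _.
have [t0 t0E] := plt_perm (pletter h).
have tE t : compat t h = (t == t0).
  apply/compatP/eqP => [tE|->//]; by apply: perm_order_inj => i j; rewrite t0E.
rewrite (eq_bigl (fun t => (t == t0) && shuffle_perm p1 p2 t0)); last first.
  by move=> t; rewrite tE andbC; case: eqP => // ->.
rewrite big_mkcondr big_pred1_eq; congr (if _ then _ else _).
apply/andP/andP => -[H1 H2]; split.
- by apply/'forall_'forall_eqP => i j; rewrite (compatP _ _ H1) pl t0E.
- by apply/'forall_'forall_eqP => i j; rewrite (compatP _ _ H2) pr t0E.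
- by apply/compatP => i j; rewrite pl -t0E; move/'forall_'forall_eqP: H1 => ->.
- by apply/compatP => i j; rewrite pr -t0E; move/'forall_'forall_eqP: H2 => ->.
Qed.

End Truncation.

(** The coefficient at [m] of a product involves only divisors of [m], so a single bound on the
    variables of [m] truncates both factors and the result. *)
Lemma Lperm_mul (K : comNzRingType) (q : K) n1 n2 (p1 : 'S_n1) (p2 : 'S_n2) :
  Lperm q p1 * Lperm q p2 = \sum_(t | shuffle_perm p1 p2 t) Lperm q t.
Proof.
apply/fpsP => m; pose B := (\max_(i <- m) i).+1.
have mB i : i \in m -> (i < B)%N by move=> im; rewrite ltnS; apply: leq_bigmax_seq.
rewrite Defs.coef_sum; under eq_bigr => t _ do rewrite (Lperm_trunc q t mB).
rewrite -Defs.coef_sum -Ltrunc_mul !Defs.coefM; apply: eq_big_seq => d.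
rewrite in_mdivisors => dm; congr (_ * _); apply: Lperm_trunc => i id.
  by apply: mB; apply: (msubset_subset dm).
by apply: mB; apply: (msubset_subset (msubsetDl m d)).
Qed.

Lemma perm_index_enum (T : finType) : perm_eq (index_enum T) (enum T).
Proof.
by apply: uniq_perm => [||x]; rewrite ?index_enum_uniq ?enum_uniq ?mem_index_enum ?mem_enum.
Qed.

Lemma ordinal_seq n : exists e : seq 'I_n,
  [/\ size e = n, forall x (i : 'I_n), nth x e i = i & perm_eq (index_enum 'I_n) e].
Proof.
by exists (enum 'I_n); rewrite size_enum_ord perm_index_enum; split=> // x i; rewrite nth_ord_enum.
Qed.

(** * Coefficients of the series L *)

Section Coefficients.
Variables (K : comNzRingType) (q : K).
Implicit Types (m : {mset nat}) (s : seq nat).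

Lemma Lperm_homog n (p : 'S_n) m : size m != n -> Lperm q p m = 0.
Proof.
move=> mn; rewrite /Lperm coef_Gamma fsbig1// => f _.
rewrite coef_prodX; case: eqP => [mE|]; rewrite ?mulr0//.
case/eqP: mn; rewrite mE (perm_size (perm_eq_seq_mset _)) size_map.
by rewrite (perm_size (perm_index_enum _)) size_enum_ord.
Qed.

Lemma L_homog n (I : {set 'I_n.-1}) m : size m != n -> L q I m = 0.
Proof. by have [p <-] := Des_surj I; rewrite L_Des; apply: Lperm_homog. Qed.

Definition sletter n (p : 'S_n) s (b : {ffun 'I_n -> bool}) : {ffun 'I_n -> Ppm} :=
  [ffun i => (nth 0%N s (p^-1%g i), b i)].

(* The absolute values of an enriched partition with monomial m are the sorted
   letters of m, so only the signs b remain to be chosen. *)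
Lemma coef_Lperm n (p : 'S_n) m : size m = n -> Lperm q p m =
  \sum_(b : {ffun 'I_n -> bool} |
     `[< enriched (fun i j => (p^-1%g i < p^-1%g j)%N) (sletter p (sort leq m) b) >])
     \prod_i q ^+ (~~ b i).
Proof.
move=> mn; set s := sort leq m; pose lt (i j : 'I_n) := (p^-1%g i < p^-1%g j)%N.
have sn : size s = n by rewrite size_sort.
have F_inj : injective (sletter p s).
  by move=> b b' /ffunP bb'; apply/ffunP => i; have := bb' i; rewrite !ffunE => -[].
have [e [en ei ep]] := ordinal_seq n.
have pe : perm_eq (map p e) e.
  have ue : uniq e by rewrite -(perm_uniq ep) index_enum_uniq.
  have ie i : i \in e by rewrite -(perm_mem ep) mem_index_enum.
  apply: uniq_perm; rewrite ?(map_inj_uniq (@perm_inj _ p))//.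
  by move=> i; rewrite ie; apply/mapP; exists (p^-1%g i); rewrite ?permKV.
have jp (j : 'I_n -> nat) : perm_eq (map j (index_enum 'I_n)) [seq j (p a) | a <- e].
  rewrite (perm_trans (perm_map _ ep))// perm_sym.
  by rewrite (map_comp j p) perm_map.
have fF f : enriched lt f -> m = seq_mset [seq (f i).1 | i <- index_enum 'I_n] ->
    f = sletter p s [ffun i => (f i).2].
  move=> /enriched_perm_plt ef mf.
  (* In the lexicographic order of [Ppm] the absolute value cannot decrease along the chain, so
     reading [f] along [p] gives the sorted word. *)
  have -> : s = [seq (f (p a)).1 | a <- e].
    apply: (sorted_eq leq_trans anti_leq); first exact/sort_sorted/leq_total.
      apply/(sortedP 0%N) => i; rewrite size_map en => i1.
      have i0 := ltnW i1; have : plt f (p (Ordinal i0)) (p (Ordinal i1)).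
        by rewrite -ef !permK /=.
      rewrite !(nth_map (Ordinal i0)) ?en//.
      rewrite (ei _ (Ordinal i0)) (ei _ (Ordinal i1)).
      rewrite /plt => /orP[|/andP[/eqP ->//]].
      by rewrite Order.ProdLexiOrder.ltEprodlexi => /andP[].
    rewrite perm_sort mf (perm_trans (perm_eq_seq_mset _))//.
  apply/ffunP => i; rewrite !ffunE (nth_map i) ?en// ei permKV.
  exact: surjective_pairing.
rewrite /Lperm coef_Gamma (fsbigE [seq sletter p s b | b <- enum [pred b | `[< enriched lt (sletter p s b) >]]]).
- rewrite big_map big_enum_cond; apply: eq_big => [b|b _].
    by rewrite !inE; apply/andb_idr => /asboolP hE; rewrite inE.
  rewrite coef_prodX (_ : _ == _) ?mulr1.
    by apply: eq_bigr => i _; rewrite ffunE.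
  apply/eqP; rewrite -[LHS](seq_mset_id m); apply/eq_seq_msetP.
  apply: (@perm_trans _ s); first by rewrite perm_sym perm_sort.
  rewrite perm_sym (perm_trans (jp _))//.
  rewrite (_ : map _ _ = s)//; apply: (@eq_from_nth _ 0%N); rewrite size_map en//.
  move=> i i0; rewrite (nth_map (Ordinal i0)) ?en// ffunE (ei _ (Ordinal i0)) permK//.
- by rewrite map_inj_uniq ?enum_uniq.
- by move=> f /= /mapP[h + ->]; rewrite mem_enum => hE; exact: (asboolW hE).
move=> f ef nf; rewrite coef_prodX; case: eqP => [mf|]; rewrite ?mulr0//.
case/negP: nf; rewrite [f]fF//; apply: map_f.
rewrite mem_enum; apply: (asboolT (P := enriched lt _)); rewrite -fF //.
Qed.

(** Indexed like [Des], so that descents can be compared with the strict ascents they force. The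
    default letter is never read when [s] has length [n]. *)
Definition asc n s : {set 'I_n.-1} := [set i : 'I_n.-1 | (nth 0 s i < nth 0 s i.+1)%N]%SET.

Lemma ltPpmE (a a' : nat) (x x' : bool) :
  (((a, x) : Ppm) < (a', x'))%O = (a < a')%N || (a == a') && (~~ x && x').
Proof.
rewrite Order.ProdLexiOrder.ltEprodlexi /= !leEnat.
by case: (ltngtP a a') => //=; case: x x' => -[].
Qed.

Lemma enriched_sletter n (p : 'S_n) s b :
  enriched (fun i j => (p^-1%g i < p^-1%g j)%N) (sletter p s b) <->
  forall i j : 'I_n, j = i.+1 :> nat ->
   (nth 0 s i < nth 0 s j)%N \/ nth 0%N s i = nth 0%N s j /\
    (~~ b (p i) && b (p j) \/ b (p i) = b (p j) /\ ~~ b (p i) = (p j < p i)%N).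
Proof.
rewrite enriched_permP; split=> H i j ij; have := H i j ij.
  rewrite !ffunE !permK ltPpmE => -[/orP[|/andP[/eqP]]|[[]]]; first by left.
    by right; split=> //; left.
  by right; split=> //; right.
rewrite !ffunE !permK ltPpmE => -[->|[-> [->|[->]]]]; first by left.
  by left; rewrite eqxx orbT.
by right.
Qed.

End Coefficients.

Section SpecialCoefficients.
Variable K : comNzRingType.
Implicit Types (m : {mset nat}) (s : seq nat).

Lemma in_Des n (p : 'S_n) (a b : 'I_n) (k : 'I_n.-1) : k = a :> nat -> b = a.+1 :> nat ->
  (k \in Des p) = (p b < p a)%N.
Proof.
move=> ka ba; rewrite inE; apply/existsP/idP => [[x /existsP[y]]|pba].
  move=> /and3P[/eqP xk /eqP yk].
  have -> : a = x by apply/val_inj; rewrite /= xk ka.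
  by have -> : b = y by apply/val_inj; rewrite /= ba yk ka.
by exists a; apply/existsP; exists b; rewrite ka ba !eqxx.
Qed.

Lemma nth_sort_le m i : (i.+1 < size m)%N ->
  (nth 0 (sort leq m) i <= nth 0 (sort leq m) i.+1)%N.
Proof.
move=> im; have /(sortedP 0%N) := sort_sorted leq_total m; apply.
by rewrite size_sort.
Qed.

(** At [q = 0] a sign pattern with a negative entry has weight 0, and the all-positive one has
    weight 1. With positive signs only, a repeated letter is allowed exactly at a non-descent. *)
Lemma coef_L0 n (I : {set 'I_n.-1}) m :
  L (0 : K) I m = ((size m == n) && (I \subset asc n (sort leq m)))%:R.
Proof.
case: eqP => [mn|/eqP mn] /=; last exact: L_homog.
have [p <-] := Des_surj I; rewrite L_Des coef_Lperm// big_mkcond.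
rewrite (bigD1 [ffun=> true]) //= [X in _ + X]big1 ?addr0; last first.
  move=> b bT; case: ifP => // _.
  have [i bi] : exists i, ~~ b i.
    apply/existsP; apply: contraNT bT; rewrite negb_exists => /forallP bT.
    by apply/eqP/ffunP => i; rewrite ffunE; apply/negbNE.
  by rewrite (bigD1 i)//= bi expr1 mul0r.
rewrite big1 => [|i _]; last by rewrite ffunE expr0.
rewrite [RHS](_ : _ = if Des p \subset asc n (sort leq m) then 1 else 0); last by case: ifP.
congr (if _ then _ else _).
apply/asboolP/fintype.subsetP => [/enriched_sletter H k kD|H].
  have kn : (k.+1 < n)%N by rewrite -ltn_predRL.
  have := H (Ordinal (ltnW kn)) (Ordinal kn) erefl; rewrite !ffunE /= inE.
  by move=> [//|[_ [//|[_]]]]; rewrite -(@in_Des _ _ _ _ k) ?kD.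
apply/enriched_sletter => i j ij; rewrite !ffunE /=.
have im : (i.+1 < size m)%N by rewrite -ij [size m]mn ltn_ord.
have := nth_sort_le im; rewrite -ij leq_eqVlt => /orP[/eqP e|]; last by left.
right; split=> //; right; split=> //; apply/esym/negbTE/negP.
have kn : (i < n.-1)%N by rewrite ltn_predRL -ij.
rewrite -(@in_Des _ _ _ _ (Ordinal kn))// => /H; rewrite inE /= -ij e ltnn//.
Qed.

(** The factor [c] occurs once per distinct letter, at its first occurrence. Induction from the
    right end leaves the prefixes at earlier positions unchanged. *)
Lemma prod_first (c : K) s :
  \prod_(i < size s) (if nth 0%N s i \in take i s then 1 else c) = c ^+ size (undup s).
Proof.
elim/last_ind: s => [|s x IH]; first by rewrite big_ord0.
rewrite size_rcons big_ord_recr /= nth_rcons ltnn eqxx -cats1 take_size_cat//.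
rewrite (eq_bigr (fun i : 'I_(size s) => if nth 0%N s i \in take i s then 1 else c)).
  rewrite IH cats1 undup_rcons size_rcons; case: ifPn => xs.
    rewrite mulr1 -rem_filter ?undup_uniq// size_rem ?mem_undup// prednK//.
    by rewrite -mem_undup in xs; case: (undup s) xs.
  rewrite exprSr; congr (_ ^+ _ * _); congr size.
  rewrite (_ : filter _ _ = undup s)//; apply/all_filterP/allP => y /=.
  by rewrite mem_undup; apply: contraTneq => ->.
by move=> i _; rewrite nth_cat ltn_ord takel_cat// ltnW.
Qed.

Lemma sorted_first s i : sorted leq s -> (i.+1 < size s)%N ->
  (nth 0%N s i.+1 \in take i.+1 s) = (nth 0%N s i == nth 0%N s i.+1).
Proof.
move=> ss is'; apply/idP/eqP => [|<-]; last first.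
  by rewrite -[X in X \in _](nth_take 0%N (ltnSn i)) mem_nth// size_takel// ltnW.
move=> /(nthP 0%N)[j]; rewrite size_takel ?(ltnW is')// => ji.
rewrite nth_take// => e; apply/eqP; rewrite eqn_leq -[X in _ && (X <= _)%N]e.
by rewrite !(sorted_leq_nth leq_trans leqnn 0%N ss) ?inE ?(ltnW is')// (leq_trans ji) ?(ltnW is').
Qed.

Lemma Des1 n : Des (1 : 'S_n) = finset.set0.
Proof.
apply/setP => k; rewrite inE [RHS]inE; apply/existsP => -[a /existsP[b]].
by rewrite !perm1 => /and3P[/eqP -> /eqP ->]; rewrite ltnNge leqnSn.
Qed.

(** Without descents, a letter equal to its predecessor must be positive. In each block of equal
    letters only the first sign is free, which contributes the factor [1 + q]. *)
Lemma coef_L_set0 (q : K) n m : L q (finset.set0 : {set 'I_n.-1}) m =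
  if size m == n then (1 + q) ^+ size (undup m) else 0.
Proof.
case: eqP => [mn|/eqP mn] /=; last exact: L_homog.
rewrite -Des1 L_Des coef_Lperm//; set s := sort leq m.
have sn : size s = n by rewrite size_sort.
have ss : sorted leq s by apply/sort_sorted/leq_total.
(* Forbidden sign patterns are kept with weight 0, so that the sum over all patterns factors over
   the positions. *)
transitivity (\sum_(b : {ffun 'I_n -> bool}) \prod_i
    (if b i then 1 else if nth 0%N s i \in take i s then 0 else q)); last first.
  rewrite -(bigA_distr_bigA (fun (i : 'I_n) x => 
    (if x then 1 else if nth 0%N s i \in take i s then 0 else q))).
  rewrite (_ : size (undup m) = size (undup s)); last first.
    by apply/perm_size/perm_undup => i; rewrite mem_sort.
  rewrite -prod_first -sn; apply: eq_bigr => i _; rewrite big_bool /=.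
  by case: ifP; rewrite ?addr0.
rewrite big_mkcond; apply: eq_bigr => b _.
case: ifPn => [/asboolP/enriched_sletter H|nH].
  apply: eq_bigr => i _; case: ifPn => bi /=; rewrite ?expr0 ?expr1//.
  case: i bi => -[|i] in0 bi /=; first by rewrite take0.
  rewrite sorted_first ?sn//; case: eqP => // e; exfalso.
  have := H (Ordinal (ltnW in0)) (Ordinal in0) erefl; rewrite /= e ltnn.
  rewrite !perm1 (negbTE bi) andbF /= => -[//|[_ [//|[-> /=]]]].
  by rewrite ltnNge leqnSn.
have [i /andP[bi si]] : exists i, ~~ b i && (nth 0%N s i \in take i s).
  apply/existsP; apply: contraNT nH; rewrite negb_exists => /forallP H.
  apply/asboolP/enriched_sletter => i j ij; rewrite !perm1.
  have is' : (i.+1 < size s)%N by rewrite -ij [size s]sn ltn_ord.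
  have := H j; rewrite negb_and negbK ij sorted_first//.
  have := nth_sort_le (m := m) (i := i); rewrite -/s -(size_sort leq) => /(_ is').
  rewrite leq_eqVlt => /orP[/eqP e|]; last by left.
  rewrite e eqxx orbF => bj; right; split=> //; rewrite bj.
  case: (b i); [right|by left].
  by split=> //; apply/esym/negbTE; rewrite -leqNgt leqnSn.
by rewrite (bigD1 i)//= (negbTE bi) si mul0r.
Qed.

End SpecialCoefficients.

(** * Monomials and ascent sets *)

Lemma sort_seq_mset (s : seq nat) : sort leq (seq_mset s) = sort leq s.
Proof. exact/(perm_sortP leq_total leq_trans anti_leq)/perm_eq_seq_mset. Qed.

Lemma size_seq_mset (s : seq nat) : size (seq_mset s) = size s.
Proof. exact/perm_size/perm_eq_seq_mset. Qed.

Lemma asc_sort_map n (r : seq nat) (u : nat -> nat) : size r = n ->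
  {in r &, {mono u : x y / (x <= y)%N}} ->
  asc n (sort leq (map u r)) = asc n (sort leq r).
Proof.
move=> rn um.
have -> : sort leq (map u r) = map u (sort leq r).
  apply: (sorted_eq leq_trans anti_leq); first exact/sort_sorted/leq_total.
    apply: (homo_sorted_in (e := leq) (P := mem r)).
    - by move=> x y xr yr; rewrite um.
    - by apply/allP => x; rewrite mem_sort.
    - exact/sort_sorted/leq_total.
  by rewrite perm_sort perm_map// perm_sym perm_sort.
apply/setP => k; rewrite !inE.
have kn : (k.+1 < n)%N by rewrite -ltn_predRL.
have kn' := ltnW kn; rewrite !(nth_map 0%N) ?size_sort ?rn//.
by rewrite !ltnNge um// -(mem_sort leq) mem_nth// size_sort rn.
Qed.

Section Rank.
Variables (n : nat) (J : {set 'I_n.-1}).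

(** The letter at position [a] of the least weakly increasing word with ascent set [J]. *)
Definition rank (a : nat) := #|[set j in J | (j < a)%N]%SET|.

Lemma rank0 : rank 0 = 0%N.
Proof. by apply/eqP; rewrite cards_eq0; apply/eqP/setP => j; rewrite !inE andbF. Qed.

Lemma rankS (a : 'I_n.-1) : rank a.+1 = (rank a + (a \in J))%N.
Proof.
rewrite /rank; have [aJ|aJ] := boolP (a \in J).
  rewrite (_ : [set _ | _ & _]%SET = a |: [set j in J | (j < a)%N])%SET.
    by rewrite cardsU1 !inE ltnn andbF addnC.
  apply/setP => x; rewrite !inE ltnS leq_eqVlt val_eqE.
  by case: eqP => [->|] //; rewrite aJ.
rewrite addn0; apply: eq_card => x; rewrite !inE ltnS leq_eqVlt val_eqE.
by case: eqP => [->|] //; rewrite (negbTE aJ).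
Qed.

Lemma leq_rank a b : (a <= b)%N -> (rank a <= rank b)%N.
Proof.
move=> ab; apply/subset_leq_card/fintype.subsetP => x; rewrite !inE.
by move=> /andP[-> xa]; apply: leq_trans xa ab.
Qed.

Definition ranks := mkseq rank n.

Lemma sorted_ranks : sorted leq ranks.
Proof.
apply/(sortedP 0%N) => i; rewrite size_mkseq => i1.
by have i0 := ltnW i1; rewrite !nth_mkseq// leq_rank.
Qed.

Lemma asc_ranks : asc n ranks = J.
Proof.
apply/setP => k; rewrite inE.
have kn : (k.+1 < n)%N by rewrite -ltn_predRL.
have kn' := ltnW kn; rewrite !nth_mkseq// rankS.
by case: (k \in J); rewrite ?addn1 ?addn0 ?ltnS ?leqnn ?ltnn.
Qed.

(* The packed monomial whose sorted word has ascent set J. *)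
Definition mon : {mset nat} := seq_mset ranks.

Lemma size_mon : size mon = n.
Proof. by rewrite size_seq_mset size_mkseq. Qed.

Lemma asc_mon : asc n (sort leq mon) = J.
Proof. by rewrite sort_seq_mset sorted_sort ?asc_ranks ?sorted_ranks//; exact: leq_trans. Qed.

(** Successive ranks grow by at most one, so no value is skipped; this is why [mon] uses an initial
    segment of the variables. *)
Lemma mem_ranks x a : (a < n)%N -> (x <= rank a)%N -> x \in ranks.
Proof.
elim: a => [|a IH] an.
  rewrite rank0 leqn0 => /eqP ->; rewrite -rank0.
  by apply/map_f; rewrite mem_iota.
have an' : (a < n.-1)%N by rewrite ltn_predRL.
rewrite (rankS (Ordinal an')) /= => xa.
have [/IH -> //|ax] := leqP x (rank a); first exact: ltnW.
have -> : x = rank a.+1.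
  apply/eqP; rewrite eqn_leq (rankS (Ordinal an')) xa /=.
  by rewrite (leq_trans _ ax)// -addn1 leq_add2l; case: (_ \in _).
by apply/map_f; rewrite mem_iota.
Qed.

End Rank.

(** A sorted word and the rank word of its ascent set grow at the same steps. Renaming ranks to
    letters is therefore well defined and strictly increasing. *)
Lemma rank_asc n s i j : sorted leq s -> size s = n -> (i <= j < n)%N ->
  (nth 0 s i < nth 0 s j)%N = (rank (asc n s) i < rank (asc n s) j)%N.
Proof.
move=> ss sn /andP[]; elim: j => [|j IH]; first by rewrite leqn0 => /eqP -> _; rewrite !ltnn.
rewrite leq_eqVlt => /orP[/eqP -> _|ij jn]; first by rewrite !ltnn.
have jn' : (j < n.-1)%N by rewrite ltn_predRL.
have js : (j < n)%N := ltnW jn.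
have ij' := IH ij js.
have sij : (nth 0 s i <= nth 0 s j)%N.
  by rewrite (sorted_leq_nth leq_trans leqnn 0%N ss) ?inE ?sn// (leq_ltn_trans _ js).
have sj : (nth 0 s j <= nth 0 s j.+1)%N.
  by rewrite (sorted_leq_nth leq_trans leqnn 0%N ss) ?inE ?sn//.
rewrite (rankS _ (Ordinal jn')) inE /=.
move: sj; rewrite leq_eqVlt => /orP[/eqP <-|sj]; first by rewrite ltnn addn0.
by rewrite sj addn1 ltnS leq_rank// (leq_ltn_trans sij sj).
Qed.

Section QSymCoef.
Variable K : comNzRingType.

(** Passes from the exponent vectors in the definition of [QSym] to words: the exponents are the
    multiplicities in [r], positive because [r] uses every letter below [p]. *)
Lemma QSym_map (f : fps K nat) p (r : seq nat) (u : nat -> nat) : QSym f ->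
  (forall x, (x \in r) = (x < p)%N) ->
  (forall x y, (x < y < p)%N -> (u x < u y)%N) ->
  f (seq_mset (map u r)) = f (seq_mset r).
Proof.
move=> [_ fq] rp um; pose k (a : 'I_p) := count_mem (val a) r.
have k0 a : (0 < k a)%N by rewrite -has_count has_pred1 rp ltn_ord.
have Hq : f (monom (fun a : 'I_p => u a) k) = f (monom (@nat_of_ord p) k).
  by apply: fq => // a b ab; apply: um; rewrite ab ltn_ord.
have E : perm_eq (flatten [seq nseq (k a) (val a) | a <- enum 'I_p]) r.
  apply/allP => x _ /=; apply/eqP.
  rewrite count_flatten sumnE !big_map. rewrite -enumT big_enum /=.
  under eq_bigr do rewrite count_nseq /=.
  have [xp|px] := ltnP x p.
    rewrite (bigD1 (Ordinal xp))//= eqxx mul1n big1 ?addn0// => a.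
    by rewrite -val_eqE /= => /negbTE ->; rewrite mul0n.
  rewrite big1 => [|a _]; first by apply/esym/count_memPn; rewrite rp -leqNgt.
  by rewrite (_ : (_ == _) = false) ?mul0n//; apply/negbTE; rewrite ltn_eqF ?(leq_trans _ px).
have -> : seq_mset r = monom (@nat_of_ord p) k.
  by apply/eq_seq_msetP; rewrite perm_sym.
rewrite -Hq; congr (f _); apply/eq_seq_msetP.
rewrite perm_sym; have := perm_map u E; rewrite map_flatten -map_comp.
by under eq_map do rewrite /= map_nseq.
Qed.

Lemma QSym_asc (f : fps K nat) n (m : {mset nat}) : QSym f -> size m = n ->
  f m = f (mon (asc n (sort leq m))).
Proof.
move=> fq mn; set s := sort leq m; set J := asc n s.
have sn : size s = n by rewrite size_sort.
have ss : sorted leq s by apply/sort_sorted/leq_total.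
(* The letter of [s] that replaces the packed letter [j], read at the first position carrying [j];
   by [rank_asc] every such position gives the same letter. *)
pose u j := nth 0%N s (index j (ranks J)).
have ru a : (a < n)%N -> u (rank J a) = nth 0%N s a.
  move=> an; have ra : rank J a \in ranks J by apply/map_f; rewrite mem_iota.
  rewrite /u; set b := index _ _.
  have bn : (b < n)%N by rewrite -[X in (_ < X)%N](size_mkseq (rank J)) index_mem.
  have rb : rank J b = rank J a by rewrite -(nth_mkseq 0%N (rank J) bn) nth_index.
  have H x y : (x <= y)%N -> (y < n)%N -> rank J x = rank J y ->
      nth 0%N s x = nth 0%N s y.
    move=> xy yn e; apply/eqP; rewrite eqn_leq [X in _ && X]leqNgt.
    rewrite (rank_asc ss sn) ?xy// -/J e ltnn andbT.
    by rewrite (sorted_leq_nth leq_trans leqnn 0%N ss) ?inE ?sn// (leq_ltn_trans xy).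
  by case/orP: (leq_total a b) => ab; [apply/esym|]; apply: H.
have su : s = map u (ranks J).
  apply: (@eq_from_nth _ 0%N); rewrite ?size_map ?size_iota// sn => i i0.
  by rewrite (nth_map 0%N) ?size_mkseq// nth_mkseq// ru.
rewrite -[m in LHS]seq_mset_id (_ : seq_mset m = seq_mset s); last first.
  by apply/eq_seq_msetP; rewrite perm_sym perm_sort.
(* The number of distinct packed letters: one more than the last, hence largest, rank, and 0 for the
   empty word. *)
pose p := if n is n'.+1 then (rank J n').+1 else 0%N.
have rp x : (x \in ranks J) = (x < p)%N.
  apply/idP/idP => [/mapP[a]|].
    rewrite mem_iota add0n /= /p => + ->; case: (n) (J) => // n' J'.
    by rewrite !ltnS; apply: leq_rank.
  rewrite /p; case: (n) (J) => // n' J'; rewrite ltnS; exact: mem_ranks.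
rewrite su (QSym_map fq rp)// => x y /andP[xy yp].
have := yp; rewrite -rp => /mapP[b]; rewrite mem_iota add0n /= => bn yb.
have := ltn_trans xy yp; rewrite -rp => /mapP[a]; rewrite mem_iota add0n /= => an xa.
rewrite xa yb !ru// (rank_asc ss sn) -/J -?xa -?yb// bn andbT leqNgt.
by apply/negP => /ltnW/(leq_rank J); rewrite -xa -yb leqNgt xy.
Qed.

Lemma QSym_L0 n (I : {set 'I_n.-1}) : QSym (L (0 : K) I).
Proof.
split; first by exists n => m mn; rewrite L_homog// gtn_eqF.
move=> p i k im k0; rewrite !coef_L0.
(* Extends [i] to all of [nat]; the letters of the packed monomial are below [p], so the default is
   not reached. *)
pose u x := if insub x is Some a then i a else 0%N.
have uE (a : 'I_p) : u a = i a by rewrite /u valK.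
have -> : monom i k = seq_mset (map u (flatten [seq nseq (k a) (val a) | a <- enum 'I_p])).
  rewrite /monom map_flatten -map_comp; congr (seq_mset (flatten _)).
  by apply: eq_map => a /=; rewrite map_nseq uE.
rewrite /monom !sort_seq_mset !size_seq_mset size_map; case: eqP => //= rn.
rewrite asc_sort_map// => x y /flatten_mapP[a _ /nseqP[-> _]] /flatten_mapP[b _ /nseqP[-> _]].
rewrite !uE; case: (ltngtP a b) => [ab|ab|/val_inj ->].
- by rewrite ltnW// im.
- by apply/negbTE; rewrite -ltnNge im.
- exact: leqnn.
Qed.

End QSymCoef.

(** * The linear map Theta *)

Section Mobius.
Variables (K : comNzRingType) (T : finType).
Implicit Types A B X : {set T}.

(** Expansion of a product over [T]: [F i] is the factor for [i] in [X] and [G i] the one for [i]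
    outside [X]. The sum [F i + G i] is 1 where [A] and [B] agree and 0 where they differ. *)
Lemma sum_sign_interval A B :
  \sum_(X : {set T} | (A \subset X) && (X \subset B)) (-1) ^+ #|B :\: X|%SET = (A == B)%:R :> K.
Proof.
pose F i : K := (i \in B)%:R; pose G i : K := if i \in A then 0 else if i \in B then -1 else 1.
have EG : \prod_i (F i + G i) = (A == B)%:R.
  case: eqP => [AB|AB]; first by rewrite big1// => i _; rewrite /F /G AB; case: (i \in B); rewrite /= ?addr0 ?add0r.
  have [i iAB] : exists i, (i \in A) != (i \in B).
    apply/existsP; apply: contra_notT AB; rewrite negb_exists => /forallP H.
    by apply/setP => i; apply/eqP; rewrite -[_ == _]negbK H.
  rewrite (bigD1 i)//= /F /G; move: iAB; case: (i \in A); case: (i \in B) => //= _.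
    by rewrite addr0 mul0r.
  by rewrite subrr mul0r.
rewrite -EG (bigA_distr 1 +%R) /= [LHS]big_mkcond; apply: eq_bigr => X _.
case: ifPn => [/andP[/fintype.subsetP AX /fintype.subsetP XB]|].
  rewrite -prodr_const big_mkcond; apply: eq_bigr => i _; rewrite /F /G !inE.
  have := AX i; have := XB i; case: (i \in X) => /=; first by move=> ->.
  by move=> _; case: (i \in A) => // /(_ isT).
rewrite negb_and => /orP[/(elimT fintype.subsetPn)[i i1 i2]|/(elimT fintype.subsetPn)[i i1 i2]].
  by rewrite (bigD1 i)//= (negbTE i2) /G i1 mul0r.
by rewrite (bigD1 i)//= i1 /F (negbTE i2) mul0r.
Qed.

Lemma sum_sign_interval_co A B :
  \sum_(X : {set T} | (A \subset X) && (X \subset B)) (-1) ^+ #|X :\: A|%SET = (A == B)%:R :> K.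
Proof.
rewrite (reindex_inj (inv_inj (@finset.setCK T))) /=.
have := sum_sign_interval (~: B)%SET (~: A)%SET.
rewrite (inj_eq (inv_inj (@finset.setCK T))) eq_sym => <-; apply: eq_big => [X|X _].
  by rewrite (finset.subsetC A) (finset.subCset X) andbC.
by rewrite !finset.setDE finset.setIC.
Qed.

End Mobius.

Section Theta.
Variable K : comNzRingType.
Implicit Types (f g : fps K nat) (q : K).

(* Moebius inversion: the coefficient of a quasisymmetric f at m depends only on the
   degree n and the ascent set J of m, and in degree n that of L 0 I is 1 if
   I \subset J and 0 otherwise. Hence acoef f I is the coordinate of f on L 0 I. *)
Definition acoef f n (I : {set 'I_n.-1}) : K :=
  \sum_(J : {set 'I_n.-1} | J \subset I) (-1) ^+ #|I :\: J|%SET * f (mon J).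

(** The coefficient at [m] uses only coordinates in degree [size m], so the sum is finite and the
    map is linear on all power series. *)
Definition Theta q f : fps K nat :=
  Fps (fun m => \sum_(I : {set 'I_(size m).-1}) acoef f I * L q I m).

Lemma acoef_linear n (I : {set 'I_n.-1}) c f g :
  acoef (c *: f + g) I = c * acoef f I + acoef g I.
Proof.
rewrite /acoef mulr_sumr -big_split; apply: eq_bigr => J _ /=.
by rewrite mulrDr mulrCA.
Qed.

Lemma Theta_linear q c f g : Theta q (c *: f + g) = c *: Theta q f + Theta q g.
Proof.
apply/fpsP => m; rewrite Defs.coefD Defs.coefZ /Theta /= /Defs.coef /=.
rewrite mulr_sumr -big_split; apply: eq_bigr => I _ /=.
by rewrite acoef_linear mulrDl mulrA.
Qed.

Lemma acoef_L0 n n' (I : {set 'I_n.-1}) (I' : {set 'I_n'.-1}) : n' != n ->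
  acoef (L 0 I') I = 0.
Proof.
by move=> nn; rewrite /acoef big1// => J _; rewrite L_homog ?mulr0// size_mon eq_sym.
Qed.

Lemma acoef_L0_same n (I I' : {set 'I_n.-1}) : acoef (L 0 I') I = (I' == I)%:R.
Proof.
rewrite -sum_sign_interval /acoef [LHS]big_mkcond [RHS]big_mkcond; apply: eq_bigr => J _.
rewrite coef_L0 size_mon eqxx asc_mon /= andbC.
by case: ifP => //=; case: ifP; rewrite ?mulr1 ?mulr0.
Qed.

Lemma ThetaE q f d : (forall m : {mset nat}, (d < size m)%N -> f m = 0) ->
  Theta q f = \sum_(n < d.+1) \sum_(I : {set 'I_n.-1}) acoef f I *: L q I.
Proof.
move=> fd; apply/fpsP => m; rewrite Defs.coef_sum.
under eq_bigr => n _ do rewrite Defs.coef_sum.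
have [md|dm] := ltnP (size m) d.+1.
  rewrite (bigD1 (Ordinal md))//= [X in _ + X]big1 ?addr0// => n nm.
  by rewrite big1// => I _; rewrite Defs.coefZ L_homog ?mulr0//; move: nm; rewrite -val_eqE eq_sym.
transitivity (0 : K).
  apply: big1 => I _; rewrite /acoef big1 ?mul0r// => J _.
  by rewrite fd ?mulr0// size_mon.
apply/esym/big1 => n _; rewrite big1// => I _; rewrite Defs.coefZ L_homog ?mulr0//.
by rewrite gtn_eqF// (leq_trans (ltn_ord n)).
Qed.

(** The converse direction of Moebius inversion: after exchanging the sums, only the ascent set of
    [m] survives. This is the spanning of [QSym] by the [L 0 I]. *)
Lemma Theta0 f : QSym f -> Theta 0 f = f.
Proof.
move=> fq; apply/fpsP => m; rewrite [RHS](QSym_asc fq erefl).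
set J0 := asc _ _; rewrite /Theta /=.
transitivity (\sum_(I : {set 'I_(size m).-1} | I \subset J0) acoef f I).
  rewrite [RHS]big_mkcond; apply: eq_bigr => I _; rewrite coef_L0 eqxx -/J0 /=.
  by case: ifP; rewrite ?mulr1 ?mulr0.
rewrite /acoef (exchange_big_dep predT)//=.
rewrite (bigD1 J0)//= [X in _ + X]big1 ?addr0 => [|J JJ0]; rewrite -mulr_suml.
  under eq_bigl do rewrite andbC.
  by rewrite sum_sign_interval_co eqxx mul1r.
under eq_bigl do rewrite andbC.
by rewrite sum_sign_interval_co (negbTE JJ0) mul0r.
Qed.

Lemma ThetaL q n (I : {set 'I_n.-1}) : Theta q (L 0 I) = L q I.
Proof.
rewrite (@ThetaE _ _ n) => [|m nm]; last by rewrite L_homog// gtn_eqF.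
rewrite (bigD1 ord_max)//= [X in _ + X]big1 ?addr0 => [|k kn].
  rewrite (bigD1 I)//= acoef_L0_same eqxx scale1r big1 ?addr0// => J JI.
  by rewrite acoef_L0_same eq_sym (negbTE JI) scale0r.
by rewrite big1// => J _; rewrite acoef_L0 ?scale0r// eq_sym.
Qed.

End Theta.

(** * Theta as a homomorphism of algebras *)

Section Hom.
Variable K : comNzRingType.
Implicit Types (f g : fps K nat) (q : K).

Lemma submod_closed_intro (V : set (fps K nat)) :
  V 0 -> (forall c f g, V f -> V g -> V (c *: f + g)) -> submod_closed (mem V).
Proof.
by move=> V0 VD; split=> [|c f g]; rewrite !in_setE//; apply: VD.
Qed.

Lemma submod_closed_inv (V : set (fps K nat)) : submod_closed (mem V) ->
  V 0 /\ forall c f g, V f -> V g -> V (c *: f + g).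
Proof.
move=> [V0 VD]; split=> [|c f g Vf Vg]; first exact: set_mem V0.
by apply: set_mem; apply: VD; apply: mem_set.
Qed.

Lemma subalg_closed_intro (V : set (fps K nat)) : V 1 ->
  (forall c f g, V f -> V g -> V (c *: f + g)) ->
  (forall f g, V f -> V g -> V (f * g)) -> subalg_closed (mem V).
Proof.
move=> V1 VD VM; split; first exact: mem_set.
  by move=> c f g /set_mem Vf /set_mem Vg; apply: mem_set; apply: VD.
by move=> f g /set_mem Vf /set_mem Vg; apply: mem_set; apply: VM.
Qed.

Lemma subalg_closed_inv (V : set (fps K nat)) : subalg_closed (mem V) ->
  [/\ V 1, forall c f g, V f -> V g -> V (c *: f + g) & forall f g, V f -> V g -> V (f * g)].
Proof.
move=> [V1 VD VM]; split; first exact: set_mem V1.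
  by move=> c f g Vf Vg; apply: set_mem; apply: VD; apply: mem_set.
by move=> f g Vf Vg; apply: set_mem; apply: VM; apply: mem_set.
Qed.

Lemma lspan_submod (A : set (fps K nat)) : submod_closed (mem (lspan A)).
Proof.
apply: submod_closed_intro => [V [/submod_closed_inv[]]//|c f g Af Ag V VA].
by have [_ VD] := submod_closed_inv VA.1; apply: VD; [apply: Af|apply: Ag].
Qed.

Lemma submod_sum (V : set (fps K nat)) (J : Type) (r : seq J) (P : pred J)
    (c : J -> K) (F : J -> fps K nat) :
  submod_closed (mem V) -> (forall i, P i -> V (F i)) ->
  V (\sum_(i <- r | P i) c i *: F i).
Proof.
move=> /submod_closed_inv[V0 VD] VF; elim/big_rec: _ => // i f Pi Vf.
by apply: VD => //; apply: VF.
Qed.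

Lemma Pq_L q n (I : {set 'I_n.-1}) : Pq q (L q I).
Proof. by apply: sub_gen_smallest; exists n, I. Qed.

Lemma Pq_submod q : submod_closed (mem (Pq q)).
Proof. exact: lspan_submod. Qed.

Lemma Pq_ind q (V : set (fps K nat)) : submod_closed (mem V) ->
  (forall n (I : {set 'I_n.-1}), V (L q I)) -> (Pq q `<=` V)%classic.
Proof. by move=> Vc VL; apply: smallest_sub => // _ [n [I ->]]; apply: VL. Qed.

Lemma QSym_submod : submod_closed (mem (@QSym K)).
Proof.
apply: submod_closed_intro => [|c f g [[d fd] fq] [[e ge] gq]].
  by split=> //; exists 0%N.
split=> [|p i k im k0]; last by rewrite !Defs.coefD !Defs.coefZ fq// gq.
exists (maxn d e) => m; rewrite gtn_max => /andP[dm em].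
by rewrite Defs.coefD Defs.coefZ fd// ge// mulr0 addr0.
Qed.

Lemma Theta_Pq q f : QSym f -> Pq q (Theta q f).
Proof.
move=> [[d fd] _]; rewrite (ThetaE q fd).
rewrite (eq_bigr (fun n : 'I_d.+1 => 1 *: \sum_(I : {set 'I_n.-1}) acoef f I *: L q I)); last first.
  by move=> n _; rewrite scale1r.
apply: submod_sum => [|n _]; first exact: Pq_submod.
by apply: submod_sum => [|I _]; [exact: Pq_submod|exact: Pq_L].
Qed.

(** Reduces closure of [QSym] under products, and linear arguments on [QSym], to the generators
    [L 0 I]. *)
Lemma QSym_Pq0 : @QSym K = Pq 0.
Proof.
apply/seteqP; split=> [f fq|]; first by rewrite -(Theta0 fq); apply: Theta_Pq.
by apply: Pq_ind => [|n I]; [exact: QSym_submod|exact: QSym_L0].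
Qed.

(** [P] is quantified before [q], so that [Theta_mul] can use the same expansion at [0] and at
    [q]. *)
Lemma L_mul n n' (I : {set 'I_n.-1}) (I' : {set 'I_n'.-1}) :
  exists P : pred 'S_(n + n'), forall q, L q I * L q I' = \sum_(t | P t) L q (Des t).
Proof.
have [p <-] := Des_surj I; have [p' <-] := Des_surj I'.
exists (shuffle_perm p p') => q; rewrite !L_Des Lperm_mul.
by apply: eq_bigr => t _; rewrite L_Des.
Qed.

(** Bilinear extension in two rounds: with one factor fixed, the admissible other factors form a
    submodule, so each may be taken to be a generator. *)
Lemma Pq_mul q f g : Pq q f -> Pq q g -> Pq q (f * g).
Proof.
have [P0 PD] := submod_closed_inv (Pq_submod q).
move=> Pf Pg; suff: (Pq q `<=` [set f | Pq q (f * g)])%classic by apply.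
apply: Pq_ind.
  apply: submod_closed_intro => [|c u v uP vP] /=; first by rewrite mul0r.
  by rewrite mulrDl -scalerAl; apply: PD.
move=> n I; suff: (Pq q `<=` [set g | Pq q (L q I * g)])%classic by apply.
apply: Pq_ind.
  apply: submod_closed_intro => [|c u v uP vP] /=; first by rewrite mulr0.
  by rewrite mulrDr -scalerAr; apply: PD.
move=> n' I'; change (Pq q (L q I * L q I')); have [P ->] := L_mul I I'.
under eq_bigr do rewrite -[L _ _]scale1r.
by apply: (submod_sum (V := Pq q)) => [|t _]; [exact: Pq_submod|exact: Pq_L].
Qed.

Lemma Pq_subalg q : subalg_closed (mem (Pq q)).
Proof.
split; first by rewrite in_setE -(L_0 q finset.set0); apply: Pq_L.
  by have [_] := Pq_submod q.
by move=> f g; rewrite !in_setE; apply: Pq_mul.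
Qed.

Lemma QSym_subalg : subalg_closed (mem (@QSym K)).
Proof. by rewrite QSym_Pq0; apply: Pq_subalg. Qed.

Lemma Theta_mul q f g : QSym f -> QSym g -> Theta q (f * g) = Theta q f * Theta q g.
Proof.
have T0 : Theta q 0 = 0.
  by have := Theta_linear q (-1) 0 0; rewrite scaleN1r addNr => ->; rewrite scaleN1r addNr.
rewrite QSym_Pq0 => Pf Pg; suff: (Pq 0 `<=` [set f | Theta q (f * g) = Theta q f * Theta q g])%classic by apply.
apply: Pq_ind.
  apply: submod_closed_intro => [|c u v uP vP] /=; first by rewrite mul0r T0 mul0r.
  by rewrite mulrDl -scalerAl !Theta_linear uP vP mulrDl -scalerAl.
move=> n I /=; suff: (Pq 0 `<=` [set g | Theta q (L 0 I * g) = Theta q (L 0 I) * Theta q g])%classic by apply.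
apply: Pq_ind.
  apply: submod_closed_intro => [|c u v uP vP] /=; first by rewrite mulr0 T0 mulr0.
  by rewrite mulrDr -scalerAr !Theta_linear uP vP mulrDr -scalerAr.
move=> n' I' /=; have [P PE] := L_mul I I'; rewrite PE !ThetaL PE.
elim/big_rec2: _ => // t u v _ <-.
by rewrite -[L 0 _]scale1r Theta_linear scale1r ThetaL.
Qed.

Lemma Theta_alg_hom q : is_alg_hom (@QSym K) (Pq q) (Theta q).
Proof.
split; [exact: QSym_subalg|exact: Pq_subalg|by move=> f; apply: Theta_Pq| |].
  by move=> c f g _ _; apply: Theta_linear.
split; first by rewrite -(L_0 0 finset.set0) ThetaL !L_0.
by move=> f g; rewrite !in_setE; apply: Theta_mul.
Qed.

End Hom.

(** * Symmetric functions *)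

Section MsetMap.
Implicit Types (m d : {mset nat}) (w : nat -> nat).

Definition mmap w m : {mset nat} := seq_mset (map w m).

Lemma mmapE w m x : injective w -> mmap w m (w x) = m x.
Proof.
move=> wi; rewrite mset_seqE count_map -count_mem_mset; apply: eq_count => y /=.
exact: inj_eq.
Qed.

Lemma size_mmap w m : size (mmap w m) = size m.
Proof. by rewrite size_seq_mset size_map. Qed.

Lemma mmapK w v : cancel w v -> injective v -> cancel (mmap w) (mmap v).
Proof.
move=> wK vi m; apply/msetP => x.
by rewrite -[x in LHS]wK mmapE// mmapE//; apply: can_inj wK.
Qed.

Lemma mmap_sub w m d : bijective w -> (mmap w d `<=` mmap w m) = (d `<=` m).
Proof.
move=> wb; have wi := bij_inj wb; apply/msubsetP/msubsetP => H x.
  by have := H (w x); rewrite !mmapE.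
by case: wb => v _ vK; rewrite -[x]vK !mmapE.
Qed.

Lemma mmapB w m d : bijective w -> mmap w (m `\` d) = mmap w m `\` mmap w d.
Proof.
move=> wb; have wi := bij_inj wb; apply/msetP => x.
by case: wb => v _ vK; rewrite -[x]vK msetE2 !mmapE// msetE2.
Qed.

Lemma mmapD w m d : bijective w -> mmap w (m `+` d) = mmap w m `+` mmap w d.
Proof.
move=> wb; have wi := bij_inj wb; apply/msetP => x.
by case: wb => v _ vK; rewrite -[x]vK msetE2 !mmapE// msetE2.
Qed.

Lemma mmap_msetn w k a : mmap w (msetn k a) = msetn k (w a).
Proof.
apply/msetP => x; rewrite mset_seqE enum_msetn map_nseq count_nseq msetnE /= eq_sym.
by case: ifP; rewrite ?mul1n ?mul0n.
Qed.

Lemma perm_mdivisors_mmap w m : bijective w ->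
  perm_eq (mdivisors (mmap w m)) (map (mmap w) (mdivisors m)).
Proof.
move=> wb; have [v wK vK] := wb.
have mK := mmapK wK (can_inj vK); have mK' := mmapK vK (can_inj wK).
apply: uniq_perm; rewrite ?(map_inj_uniq (can_inj mK)) ?fset_uniq// => d.
rewrite in_mdivisors; apply/idP/mapP => [dm|[e em ->]].
  by exists (mmap v d); rewrite ?mK'// in_mdivisors -(mmap_sub _ _ wb) mK'.
by rewrite mmap_sub// -in_mdivisors.
Qed.

Definition nsupp m := size (undup m).

Lemma eq_nsupp m d : m =i d -> nsupp m = nsupp d.
Proof. by move=> md; apply/perm_size/uniq_perm; rewrite ?undup_uniq// => x; rewrite !mem_undup. Qed.

Lemma nsuppDn m k a : a \notin m -> (0 < k)%N -> nsupp (m `+` msetn k a) = (nsupp m).+1.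
Proof.
move=> am k0; rewrite -[RHS]/(size (a :: undup m)); apply/perm_size/uniq_perm.
- exact: undup_uniq.
- by rewrite /= undup_uniq mem_undup am.
by move=> x; rewrite mem_undup in_msetD in_msetn k0 inE mem_undup orbC.
Qed.

Lemma nsuppBn m k a : (k < m a)%N -> nsupp (m `\` msetn k a) = nsupp m.
Proof.
move=> ka; apply: eq_nsupp => x; rewrite in_msetB msetnE in_mset.
by case: eqP => [->|//]; rewrite ka (leq_ltn_trans _ ka).
Qed.

Lemma size_msetD m d : size (m `+` d) = (size m + size d)%N.
Proof.
rewrite -size_cat; apply/perm_size/allP => x _.
by rewrite /= count_cat !count_mem_mset msetE2.
Qed.

Lemma size_msetB m d : d `<=` m -> (size (m `\` d) + size d)%N = size m.
Proof. by move=> dm; rewrite -size_msetD msetBDK. Qed.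

Lemma msub_msetn m k a : (0 < k)%N -> (msetn k a `<=` m) = (k <= m a)%N.
Proof.
move=> k0; apply/msubsetP/idP => [/(_ a)|ka x]; rewrite msetnE ?eqxx//.
by case: eqP => // ->.
Qed.

Definition fresh m := (\max_(i <- m) i).+1.

Lemma fresh_notin m : fresh m \notin m.
Proof.
apply/negP => fm; have := @leq_bigmax_seq _ m xpredT id (fresh m) fm isT.
by rewrite ltnn.
Qed.

End MsetMap.

Section LambdaAlg.
Variable K : comNzRingType.
Implicit Types (f g : fps K nat).

Lemma Lambda_subalg : subalg_closed (mem (@Lambda K)).
Proof.
split.
- rewrite in_setE; split.
    by exists 0%N => m m0; rewrite Defs.coef1 -size_mset_eq0 gtn_eqF.
  by move=> w wb m; rewrite !Defs.coef1 -!size_mset_eq0 size_mmap.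
- move=> c f g; rewrite !in_setE => -[[d fd] fs] [[e ge] gs]; split.
    exists (maxn d e) => m; rewrite gtn_max => /andP[dm em].
    by rewrite Defs.coefD Defs.coefZ fd// ge// mulr0 addr0.
  by move=> w wb m; rewrite !Defs.coefD !Defs.coefZ fs// gs.
move=> f g; rewrite !in_setE => -[[d fd] fs] [[e ge] gs]; split.
  exists (d + e)%N => m dem; rewrite Defs.coefM big_seq big1// => /= b.
  rewrite in_mdivisors => bm; have [db|bd] := ltnP d (size (b : {mset nat})).
    by rewrite fd// mul0r.
  rewrite ge ?mulr0//; rewrite -(ltn_add2r (size (b : {mset nat}))) (size_msetB bm).
  by rewrite (leq_ltn_trans _ dem)// addnC leq_add2r.
move=> w wb m; rewrite -/(mmap w m) !Defs.coefM (perm_big _ (perm_mdivisors_mmap m wb)).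
rewrite big_map; apply: eq_bigr => b _; rewrite -mmapB//.
by rewrite fs// gs.
Qed.

Lemma Lambda_hsym n : Lambda (hsym K n).
Proof.
split; first by exists n => m nm; rewrite /hsym /Defs.coef /= gtn_eqF.
by move=> w _ m; rewrite /hsym /Defs.coef /= size_mmap.
Qed.

Lemma subalg_gen_closed (A : set (fps K nat)) : subalg_closed (mem (subalg_gen A)).
Proof.
apply: subalg_closed_intro => [V [/subalg_closed_inv[]]//|c f g Af Ag V VA|f g Af Ag V VA].
  by have [_ VD _] := subalg_closed_inv VA.1; apply: VD; [apply: Af|apply: Ag].
by have [_ _ VM] := subalg_closed_inv VA.1; apply: VM; [apply: Af|apply: Ag].
Qed.

(** The transposition of [a] and [b] fixes [m], in which neither occurs. *)
Lemma Lambda_exchange f m k a b : Lambda f -> a \notin m -> b \notin m ->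
  f (m `+` msetn k a) = f (m `+` msetn k b).
Proof.
move=> [_ fs] am bm; pose w x := if x == a then b else if x == b then a else x.
have wK : involutive w.
  move=> x; rewrite /w; case: (eqVneq x a) => [->|xa]; first by rewrite eqxx; case: eqP.
  by case: (eqVneq x b) => [->|xb]; rewrite ?eqxx// (negbTE xa) (negbTE xb).
have wb : bijective w by exists w.
rewrite -(fs w wb) -/(mmap w _) mmapD// mmap_msetn {2}/w eqxx.
suff -> : mmap w m = m by [].
apply/msetP => x; rewrite -[x in LHS]wK mmapE; last exact: inv_inj.
rewrite /w; case: (eqVneq x a) => [->|xa].
  by rewrite (mset_eq0P am) (mset_eq0P bm).
by case: (eqVneq x b) => [->|//]; rewrite (mset_eq0P am) (mset_eq0P bm).
Qed.

End LambdaAlg.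

(** * Power sums and Newton's identities *)

Section PowerSums.
Variable K : comNzRingType.
Implicit Types (f g : fps K nat).

(** For [k > 0] the monomials are the pure powers x_i^k, and [head] reads off [i]; on the empty
    monomial the default still gives coefficient 0. *)
Definition psum k : fps K nat := Fps (fun m => (m == msetn k (head 0%N m))%:R).

Lemma coef_psum k (m : {mset nat}) : psum k m = (m == msetn k (head 0%N m))%:R.
Proof. by []. Qed.

Lemma coef_psumM k f m : (0 < k)%N ->
  (psum k * f) m = \sum_(i <- undup m | (k <= m i)%N) f (m `\` msetn k i).
Proof.
move=> k0; have hk i : head 0%N (msetn k i) = i.
  by rewrite enum_msetn; case: k k0.
pose s := [seq msetn k i | i <- undup m & (k <= m i)%N].
have us : uniq s.
  by rewrite map_inj_uniq ?filter_uniq ?undup_uniq//; apply: msetn_inj.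
have sm : {subset s <= mdivisors m}.
  by move=> _ /mapP[i + ->]; rewrite mem_filter in_mdivisors msub_msetn// => /andP[].
rewrite Defs.coefM -[RHS]big_filter -[RHS](big_map (msetn k) xpredT (fun d => f (m `\` d))) -/s.
transitivity (\sum_(d <- mdivisors m | d \in s) psum k d * f (m `\` d)).
  rewrite [RHS]big_mkcond; apply: eq_big_seq => d dm; case: ifPn => // ds.
  rewrite coef_psum; case: eqP => [dE|]; rewrite ?mul0r//.
  case/negP: ds; rewrite in_mdivisors dE msub_msetn// in dm.
  rewrite dE; apply: map_f; rewrite mem_filter dm mem_undup in_mset.
  exact: leq_trans k0 dm.
rewrite -[LHS]big_filter (perm_big s).
  rewrite /s !big_map; apply: eq_bigr => i _.
  by rewrite coef_psum hk eqxx mul1r.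
apply: uniq_perm; rewrite ?filter_uniq ?fset_uniq// => d.
by rewrite mem_filter andb_idr// => /sm.
Qed.

Lemma hsym0 : hsym K 0 = 1.
Proof. by apply/fpsP => m; rewrite Defs.coef1 /hsym /Defs.coef /= size_mset_eq0. Qed.

Lemma sum_mult (m : {mset nat}) : (\sum_(i <- undup m) m i = size m)%N.
Proof. by rewrite size_mset; apply/perm_big/perm_undup_mset. Qed.

Lemma mult_size (m : {mset nat}) i : (m i <= size m)%N.
Proof. by rewrite -count_mem_mset count_size. Qed.

Lemma sum_ltn n a : (a <= n)%N -> (\sum_(k < n | (k < a)%N) 1 = a)%N.
Proof. by move=> an; rewrite -(big_ord_widen n (fun=> 1%N) an) sum1_card card_ord. Qed.

(** At a monomial of degree [n] the right side counts pairs of a variable and a positive power of it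
    dividing the monomial. Their number is the sum of the exponents. *)
Lemma newton n : n%:R *: hsym K n = \sum_(k < n) psum k.+1 * hsym K (n - k.+1)%N.
Proof.
apply/fpsP => m; rewrite Defs.coefZ Defs.coef_sum.
under eq_bigr => k _ do rewrite coef_psumM//.
transitivity (\sum_(k < n) \sum_(i <- undup m | (k < m i)%N) (size m == n)%:R : K); last first.
  apply: eq_bigr => k _; apply: eq_bigr => i ki; rewrite /hsym /Defs.coef /=.
  rewrite -[X in _ = (nat_of_bool X)%:R](eqn_add2r k.+1) subnK//.
  by rewrite -[in LHS](size_msetB (m := m) (d := msetn k.+1 i)) ?msub_msetn// enum_msetn size_nseq.
rewrite {1}/hsym /Defs.coef /=; case: eqP => [mn|_]; last first.
  by rewrite mulr0 big1// => k _; rewrite big1.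
rewrite mulr1 -mn -{1}sum_mult natr_sum.
under [RHS]eq_bigr => k _ do rewrite big_mkcond.
rewrite exchange_big; apply: eq_bigr => i _.
by rewrite -big_mkcond -[in LHS](sum_ltn (mult_size m i)) natr_sum.
Qed.

End PowerSums.

(** * Generation of Lambda by the complete homogeneous functions *)

Section Generation.
Variable K : numFieldType.
Local Notation V := (subalg_gen (range (hsym K))).

(** The last term of Newton's identity is the top power sum times h_0 = 1, so the identity is solved
    for it without division. *)
Lemma psum_gen k : (0 < k)%N -> V (psum K k).
Proof.
have Vc := subalg_gen_closed (range (hsym K)).
have [V0 _] := submod_closed_inv (GRing.subalg_closedZ Vc).
have [_ VD VM] := subalg_closed_inv Vc.
have Vh n : V (hsym K n) by apply: sub_gen_smallest; exists n.
elim/ltn_ind: k => -[//|k] IH _.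
pose A := \sum_(j < k) psum K j.+1 * hsym K (k.+1 - j.+1)%N.
have -> : psum K k.+1 = k.+1%:R *: hsym K k.+1 + ((-1) *: A + 0).
  have aux (a b : fps K nat) : b = a + b * 1 + ((-1) *: a + 0).
    by rewrite mulr1 scaleN1r addr0 addrAC addrN add0r.
  by rewrite newton big_ord_recr subnn hsym0 -aux.
apply: (VD) => //; apply: (VD) => //; rewrite /A.
elim/big_rec: _ => // j g _ Vg; rewrite -[_ * _]scale1r; apply: (VD) => //.
by apply: (VM) => //; apply: IH; rewrite // ltnS ltn_ord.
Qed.

(* The coefficient of x_j ^ k in f, for a variable x_j not occurring in m; on
   symmetric f the choice of j is irrelevant. *)
Definition skew k (f : fps K nat) : fps K nat := Fps (fun m => f (m `+` msetn k (fresh m))).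

Lemma coef_skew k f m : skew k f m = f (m `+` msetn k (fresh m)).
Proof. by []. Qed.

(** A permutation [w] need not send [fresh m] to the fresh variable of the image, but
    [Lambda_exchange] allows either to be used. *)
Lemma skew_Lambda k f : Lambda f -> Lambda (skew k f).
Proof.
move=> fL; have [[d fd] fs] := fL; split.
  by exists d => m dm; apply: fd; rewrite size_msetD ltn_addr.
move=> w wb m; rewrite !coef_skew -/(mmap w m).
have wi := bij_inj wb.
rewrite (Lambda_exchange k (b := w (fresh m)) fL (fresh_notin _)); last first.
  by rewrite in_mset mmapE// -in_mset fresh_notin.
by rewrite -mmap_msetn -mmapD//; apply: fs.
Qed.

(* Induction on the maximal number l of variables in a monomial of f: on monomials
   with exactly l variables, \sum_k psum k * skew k f equals l times f. *)
Lemma Lambda_gen : (@Lambda K `<=` V)%classic.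
Proof.
have Vc := subalg_gen_closed (range (hsym K)).
have [V0 _] := submod_closed_inv (GRing.subalg_closedZ Vc).
have [V1 VD VM] := subalg_closed_inv Vc.
have LV : (V `<=` @Lambda K)%classic.
  by apply: smallest_sub; [exact: Lambda_subalg|move=> _ [n _ <-]; exact: Lambda_hsym].
have [_ LD _] := subalg_closed_inv (Lambda_subalg K).
suff H l : forall f, Lambda f -> (forall m, (l < nsupp m)%N -> f m = 0) -> V f.
  move=> f fL; have [[d fd] _] := fL; apply: (H d) => // m dm; apply: fd.
  by rewrite (leq_trans dm)// size_undup.
elim: l => [|l IH] f fL fl.
  have -> : f = f mset0 *: 1 + 0; last exact: VD.
  apply/fpsP => m; rewrite Defs.coefD Defs.coefZ Defs.coef1 addr0.
  case: eqP => [->|m0]; first by rewrite mulr1.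
  rewrite mulr0 fl// lt0n size_eq0; apply: contra_notN m0 => /eqP/undup_nil m0.
  by apply/eqP; rewrite -size_mset_eq0 m0.
have [[d fd] _] := fL.
(* Splitting off a power of a new variable uses up one variable, so the induction hypothesis applies
   to [skew k f]. *)
have Vs k : (0 < k)%N -> V (skew k f).
  move=> k0; apply: IH; first exact: skew_Lambda.
  by move=> m lm; apply: fl; rewrite nsuppDn// fresh_notin.
(* Exponents in monomials of [f] are at most its degree bound [d], so [d] terms suffice. *)
pose P := \sum_(k < d) psum K k.+1 * skew k.+1 f.
have VP : V P.
  rewrite /P; elim/big_rec: _ => // k g _ Vg; rewrite -[_ * _]scale1r; apply: (VD) => //.
  by apply: (VM); [exact: psum_gen|exact: Vs].
have Vg : V ((- l.+1%:R^-1) *: P + f).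
  apply: IH; first by apply: LD => //; apply: LV.
  move=> m lm; rewrite Defs.coefD Defs.coefZ Defs.coef_sum.
  under eq_bigr => k _ do rewrite coef_psumM//.
  (* Removing only part of the power of [i] keeps that variable; the fresh one then makes more than
     [l.+1] variables, where [f] vanishes. Only removing the full power survives. *)
  have E k i : (k < m i)%N -> skew k.+1 f (m `\` msetn k.+1 i) = if k.+1 == m i then f m else 0.
    move=> ki; case: eqP => [kE|kE].
      rewrite coef_skew (Lambda_exchange _ (b := i) fL (fresh_notin _)).
        by rewrite msetBDK// msub_msetn.
      by rewrite in_mset msetE2 msetnxx kE subnn.
    rewrite coef_skew; apply: fl; rewrite nsuppDn ?fresh_notin// nsuppBn//.
    by rewrite ltn_neqAle ki andbT; apply/eqP.
  have [fm|fm] := eqVneq (f m) 0.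
    rewrite fm addr0 big1 ?mulr0// => k _; rewrite big1// => i ki.
    by rewrite E// fm; case: ifP.
  have md : (size m <= d)%N by rewrite leqNgt; apply: contraNN fm => /fd ->.
  have ml : nsupp m = l.+1.
    apply/eqP; rewrite eqn_leq lm andbT leqNgt; apply: contraNN fm => /fl ->//.
  (* Each of the [l.+1] variables contributes [f m] once, at the [k] for which [k.+1] is its
     exponent. *)
  rewrite (_ : \sum_(k < d) _ = l.+1%:R * f m); last first.
    transitivity (\sum_(i <- undup m) f m); last first.
      by rewrite big_const_seq count_predT -/(nsupp m) ml iter_addr_0 mulr_natl.
    under eq_bigr => k _ do rewrite big_mkcond.
    rewrite exchange_big big_seq [RHS]big_seq; apply: eq_bigr => i; rewrite mem_undup in_mset => mi.
    have kd : ((m i).-1 < d)%N by rewrite prednK// (leq_trans _ md)// mult_size.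
    have mi' : ((m i).-1 < m i)%N by rewrite prednK.
    rewrite (bigD1 (Ordinal kd))//= mi' E// prednK// eqxx big1 ?addr0// => k kk.
    case: ifP => // ki; rewrite E//; case: eqP => // kE; case/eqP: kk.
    by apply/val_inj; rewrite /= -kE.
  by rewrite mulNr mulKf ?Num.Theory.pnatr_eq0// addNr.
rewrite (_ : f = l.+1%:R^-1 *: P + ((- l.+1%:R^-1) *: P + f)); first exact: VD.
by rewrite addrA -scalerDl addrN scale0r add0r.
Qed.

End Generation.

(** * The series q_n *)

Section QnCoefficients.
Variables (K : comNzRingType) (t : K).
Local Notation S := (fps K nat).
Implicit Types (m : {mset nat}) (d : {mset unit}).

(* The coefficients of the partial product over i < N. *)
Definition qn_closed N : fps S unit := Fps (fun d => Fps (fun m =>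
  if (size m == size d) && all (fun i => i < N)%N m then (1 - t) ^+ nsupp m else 0)).

Lemma coef_qn_closed N d m : qn_closed N d m =
  if (size m == size d) && all (fun i => i < N)%N m then (1 - t) ^+ nsupp m else 0.
Proof. by []. Qed.

Lemma qn_closed0 : qn_closed 0 = 1.
Proof.
apply/fpsP => d; apply/fpsP => m; rewrite coef_qn_closed Defs.coef1.
have [-> | m0] := eqVneq m mset0.
  rewrite enum_mset0 /= andbT eq_sym size_mset_eq0 /nsupp enum_mset0 expr0.
  by case: eqP => _; rewrite ?Defs.coef1 ?eqxx.
rewrite (_ : all _ m = false); last first.
  have [m00|[x xm]] := mset_0Vmem m; first by rewrite m00 eqxx in m0.
  by apply/negbTE; rewrite -has_predC; apply/hasP; exists x.
rewrite andbF; case: (_ == _); rewrite ?Defs.coef1 ?(negbTE m0)//.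
Qed.

Lemma coef_linear_factorM (c : S) (F : fps S unit) d :
  (F * (1 - c *: fpsX S tt)) d = F d - (if tt \in d then c * F (d `\ tt) else 0).
Proof.
rewrite mulrC mulrBl mul1r -scalerAl Defs.coefD Defs.coefN Defs.coefZ Defs.coefXM.
by case: ifP => _; rewrite ?mulr0.
Qed.

(* Clearing the denominator 1 - x_N u makes the recursion a local identity. *)
Lemma qn_closedS N :
  qn_closed N.+1 * (1 - fpsX K N *: fpsX S tt) =
  qn_closed N * (1 - (t *: fpsX K N) *: fpsX S tt).
Proof.
apply/fpsP => d; rewrite !coef_linear_factorM; apply/fpsP => m.
rewrite !Defs.coefD !Defs.coefN.
have allN : N \notin m -> all (fun i => i < N.+1)%N m = all (fun i => i < N)%N m.
  move=> Nm; apply: eq_in_all => i im; rewrite ltnS leq_eqVlt.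
  by case: eqP => // iN; rewrite -iN im in Nm.
have [dt|dt] := boolP (tt \in d); last first.
  rewrite !coef_qn_closed.
  have -> : size d = 0%N.
    apply/eqP; rewrite size_mset_eq0; apply/eqP/msetP => -[]; rewrite mset0E.
    exact/mset_eq0P.
  by case: eqP => // /eqP; rewrite size_mset_eq0 => /eqP ->; rewrite enum_mset0.
rewrite -scalerAl Defs.coefZ !Defs.coefXM; case: ifPn => Nm; last first.
  by rewrite mulr0 !coef_qn_closed allN.
rewrite !coef_qn_closed (size_msetB1 Nm) (size_msetB1 dt) eqSS.
have E : all (fun i => i < N.+1)%N m = all (fun i => i < N.+1)%N (m `\ N).
  apply/allP/allP => H i im.
    by apply: H; move: im; rewrite in_msetB1 => /andP[].
  have [->//|iN] := eqVneq i N.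
  by apply: H; rewrite in_msetB1 (negbTE iN).
have -> : all (fun i => i < N)%N m = false.
  by apply/negbTE; rewrite -has_predC; apply/hasP; exists N => //=; rewrite ltnn.
rewrite andbF -E; case: eqP => _ /=; last by rewrite mulr0.
(* If x_N occurs at least twice, removing one copy keeps the set of variables and the two terms on
   the left cancel. *)
have [N1|N1] := boolP (N \in m `\ N).
  have -> : all (fun i => i < N)%N (m `\ N) = false.
    by apply/negbTE; rewrite -has_predC; apply/hasP; exists N => //=; rewrite ltnn.
  rewrite mulr0 subr0; have -> : nsupp (m `\ N) = nsupp m; last by rewrite subrr.
  by apply: nsuppBn; rewrite -msetB11.
(* If x_N occurs once, the identity becomes (1 - t)^(s+1) - (1 - t)^s = - t (1 - t)^s, where s
   counts the other variables. *)
rewrite E (_ : all (fun i => i < N.+1)%N (m `\ N) = all (fun i => i < N)%N (m `\ N)); last first.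
  apply: eq_in_all => i im; rewrite ltnS leq_eqVlt.
  by case: eqP => // iN; rewrite iN (negbTE N1) in im.
case: ifP => _; last by rewrite mulr0.
have -> : nsupp m = (nsupp (m `\ N)).+1.
  by rewrite -(nsuppDn N1 (ltn0Sn 0)) msetDC msetB1K.
by rewrite exprS mulrBl mul1r addrAC subrr !add0r.
Qed.

Lemma prod_qn_factor N : \prod_(i < N) qn_factor t i = qn_closed N.
Proof.
elim: N => [|N IH]; first by rewrite big_ord0 qn_closed0.
rewrite big_ord_recr /= IH /qn_factor mulrA -qn_closedS -mulrA geomE mulr1//.
Qed.

Lemma coef_qn n m : qn t n m = if size m == n then (1 - t) ^+ nsupp m else 0.
Proof.
have mN i : i \in m -> (i < (\max_(i <- m) i).+1)%N.
  by move=> im; rewrite ltnS; apply: (@leq_bigmax_seq _ m xpredT id i im isT).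
rewrite -(qn_stable t n mN) prod_qn_factor coef_qn_closed enum_msetn size_nseq.
by rewrite (_ : all _ m) ?andbT//; apply/allP.
Qed.

End QnCoefficients.

Lemma qn_L (K : comNzRingType) (q : K) n :
  qn (- q) n = L q (finset.set0 : {set 'I_n.-1}).
Proof. by apply/fpsP => m; rewrite coef_qn coef_L_set0 opprK. Qed.

Lemma hsym_L (K : comNzRingType) n : hsym K n = L 0 (finset.set0 : {set 'I_n.-1}).
Proof.
apply/fpsP => m; rewrite coef_L_set0 addr0 expr1n.
by rewrite /hsym /Defs.coef /=; case: eqP.
Qed.

(** * Restriction of Theta to symmetric functions *)

Section ThetaLambda.
Variables (K : numFieldType) (q : K).

Lemma Lambda_ind (V : set (fps K nat)) : subalg_closed (mem V) ->
  (forall n, V (hsym K n)) -> (@Lambda K `<=` V)%classic.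
Proof.
move=> Vc Vh; apply: subset_trans (@Lambda_gen K) _.
by apply: smallest_sub => // _ [n _ <-]; apply: Vh.
Qed.

Lemma Lambda_QSym : (@Lambda K `<=` @QSym K)%classic.
Proof.
by apply: Lambda_ind => [|n]; [exact: QSym_subalg|rewrite hsym_L; exact: QSym_L0].
Qed.

Lemma Theta_hsym n : Theta q (hsym K n) = qn (- q) n.
Proof. by rewrite hsym_L ThetaL qn_L. Qed.

Lemma Lambda_t_Pq : (Lambda_t (- q) `<=` Pq q)%classic.
Proof.
apply: smallest_sub; first exact: Pq_subalg.
by move=> _ [n _ <-]; rewrite qn_L; apply: Pq_L.
Qed.

(** Supplies the existence that makes [theta] a genuine homomorphism instead of its default
    value. *)
Lemma is_theta_Theta : is_theta (- q) (Theta q).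
Proof.
have [Qc _ _ _ [T1 TM]] := Theta_alg_hom q.
split=> [|n]; last exact: Theta_hsym.
have Lc := subalg_gen_closed (range (qn (- q))).
split; [exact: Lambda_subalg|exact: Lc| | |].
(* Membership in [Lambda] is carried along because [Theta] is known to be multiplicative only on
   [QSym]. *)
- suff H : (@Lambda K `<=` [set f | Lambda f /\ Lambda_t (- q) (Theta q f)])%classic.
    by move=> f /H[].
  have [L1 LD LM] := subalg_closed_inv (Lambda_subalg K).
  have [t1 tD tM] := subalg_closed_inv Lc.
  apply: Lambda_ind => [|n]; last first.
    split; first exact: Lambda_hsym.
    by rewrite Theta_hsym; apply: sub_gen_smallest; exists n.
  apply: subalg_closed_intro => [|c f g [fL ft] [gL gt]|f g [fL ft] [gL gt]].
  - by split=> //; rewrite T1.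
  - by split; [exact: LD|rewrite Theta_linear; exact: tD].
  split; first exact: LM.
  by rewrite Theta_mul; [exact: tM|exact: Lambda_QSym|exact: Lambda_QSym].
- by move=> c f g _ _; apply: Theta_linear.
split=> // f g /set_mem fL /set_mem gL.
by apply: Theta_mul; apply: Lambda_QSym.
Qed.

(** The elements of [Lambda] on which two homomorphisms agree form a subalgebra, and this one
    contains every h_n. *)
Lemma Theta_theta f : Lambda f -> Theta q f = theta (- q) f.
Proof.
have [_ Th] := is_theta_Theta.
have [[Lc _ _ tD [t1 tM]] th] : is_theta (- q) (theta (- q)).
  exact: (xgetPex (fun=> 0) (ex_intro _ _ is_theta_Theta)).
have [L1 LD LM] := subalg_closed_inv Lc.
suff H : (@Lambda K `<=` [set f | Lambda f /\ Theta q f = theta (- q) f])%classic.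
  by move=> /H[].
have [_ _ _ _ [T1 _]] := Theta_alg_hom q.
apply: Lambda_ind => [|n]; last by split; [exact: Lambda_hsym|rewrite Th th].
apply: subalg_closed_intro => [|c u v [uL uE] [vL vE]|u v [uL uE] [vL vE]].
- by split=> //; rewrite T1 t1.
- split; first exact: LD.
  by rewrite Theta_linear uE vE tD//; apply: mem_set.
split; first exact: LM.
rewrite Theta_mul; [|exact: Lambda_QSym|exact: Lambda_QSym].
by rewrite uE vE tM//; apply: mem_set.
Qed.

End ThetaLambda.

Theorem theorem3 (R : realType) (q : R[i]) :
  exists Theta : fps R[i] nat -> fps R[i] nat,
    [/\ is_alg_hom (@QSym R[i]) (Pq q) Theta,
        forall n (I : {set 'I_n.-1}), (0 < n)%N -> Theta (L 0 I) = L q I,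
        (Lambda_t (- q) `<=` Pq q)%classic
      & forall f, Lambda f -> Theta f = theta (- q) f].
Proof.
exists (Theta q); split; [exact: Theta_alg_hom| |exact: Lambda_t_Pq|exact: Theta_theta].
by move=> n I _; apply: ThetaL.
Qed.
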